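(* Let $\alpha_1\approx 0.24760367$ be the root in $[0,1]$ of $16\alpha^4+16\alpha^3-52\alpha^2+48\alpha-9=0$. For every $\alpha$ with $0<\alpha\le \alpha_1$, the map $G_\alpha$ admits an absolutely continuous invariant probability measure (absolutely continuous with respect to two-dimensional Lebesgue measure on $[0,1]^2$).
   Context: Let $\tau:[0,1]\to[0,1]$ be the symmetric tent map, $\tau(x)=2x$ for $0\le x<1/2$ and $\tau(x)=2-2x$ for $1/2\le x\le 1$. For $0<\alpha<1$ define $G_\alpha:[0,1]^2\to[0,1]^2$ by $G_\alpha(x,y)=(y,\tau(\alpha y+(1-\alpha)x))$. *)

(* Defs.v *)
From Stdlib Require Import Reals.
Open Scope R_scope.

Definition tent (x : R) : R := if Rlt_dec x (1/2) then 2 * x else 2 - 2 * x.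

Definition G (alpha : R) (p : R * R) : R * R :=
  (snd p, tent (alpha * snd p + (1 - alpha) * fst p)).

Definition square (p : R * R) : Prop :=
  0 <= fst p <= 1 /\ 0 <= snd p <= 1.

Definition rect (a b c d : R) (p : R * R) : Prop :=
  a <= fst p <= b /\ c <= snd p <= d.

Inductive borel : (R * R -> Prop) -> Prop :=
| borel_rect : forall a b c d,
    borel (fun p => square p /\ rect a b c d p)
| borel_compl : forall A, borel A -> borel (fun p => square p /\ ~ A p)
| borel_union : forall A : nat -> (R * R -> Prop),
    (forall n, borel (A n)) -> borel (fun p => exists n, A n p).

Definition lebesgue_null (A : R * R -> Prop) : Prop :=
  forall eps, 0 < eps ->
  exists a b c d : nat -> R,
    (forall n, a n <= b n /\ c n <= d n) /\
    (forall p, A p -> exists n, rect (a n) (b n) (c n) (d n) p) /\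
    (forall N, sum_f_R0 (fun n => (b n - a n) * (d n - c n)) N <= eps).

Definition is_probability_measure (mu : (R * R -> Prop) -> R) : Prop :=
  (forall A, borel A -> 0 <= mu A) /\
  mu square = 1 /\
  (forall A : nat -> (R * R -> Prop),
     (forall n, borel (A n)) ->
     (forall m n p, m <> n -> A m p -> A n p -> False) ->
     Un_cv (fun N => sum_f_R0 (fun n => mu (A n)) N)
           (mu (fun p => exists n, A n p))).

Definition absolutely_continuous (mu : (R * R -> Prop) -> R) : Prop :=
  forall A, borel A -> lebesgue_null A -> mu A = 0.

Definition invariant (T : R * R -> R * R) (mu : (R * R -> Prop) -> R) : Prop :=
  forall A, borel A -> mu (fun p => square p /\ A (T p)) = mu A.

(* Main.v *)
(* Write d = 2 - 2a for the Jacobian of both branches of G a. If at most C d^n of the n-cylinders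
   are nonempty, then G^-n enlarges areas at most C times, because pulling back along a branch of
   G^n divides areas by d^n; an ultralimit of Cesaro means of the pushforwards of Lebesgue measure
   is then an invariant measure with density at most C.
   To count cylinders, fix N. The image of an n-cylinder under its branch of G^n is convex. If it
   contains a triangle of area bounded below, the cylinder has area at least const/d^n, so there are
   at most const d^n such cylinders. Otherwise the image is nearly contained in a segment, and by
   compactness it meets no more N-cylinders than some segment meets closed ones. This last number
   is O(rho^N) with rho < d: the fold cuts a short segment at most twice in any four steps, and in
   a suitable norm a segment is stretched at most by 3/2 < d per step, which is where a < 1/4
   enters. So the number M of nonempty cylinders satisfies M_(n+N) <= (d^N/2) M_n + const d^n. *)
Require Import Defs.
From Stdlib Require Import Reals.
Open Scope R_scope.
From Stdlib Require Import Lra.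
From mathcomp Require Import all_boot all_order all_algebra.
From mathcomp Require Import boolp classical_sets reals ereal.
From mathcomp Require Import normedtype sequences measure lebesgue_measure.
From mathcomp Require Import lebesgue_integral measurable_realfun Rstruct.
Import Order.TTheory GRing.Theory Num.Theory numFieldNormedType.Exports.
Import Defs.

(** * Counting words *)

Fixpoint words (n : nat) : seq (seq bool) :=
  if n is m.+1 then map (cons false) (words m) ++ map (cons true) (words m)
  else [:: [::]].

Definition cnt (n : nat) (P : seq bool -> Prop) : R :=
  INR (count (fun w => `[< P w >]) (words n)).

Lemma cntS n P :
  cnt n.+1 P = cnt n (fun w => P (false :: w)) + cnt n (fun w => P (true :: w)).
Proof.
rewrite /cnt /= count_cat plus_INR !count_map.
by congr (_ + _); congr INR; apply: eq_count => w.
Qed.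

Lemma cnt0 P : cnt 0 P = if `[< P [::] >] then 1 else 0.
Proof. by rewrite /cnt /= addn0; case: `[< _ >]. Qed.

Lemma cnt_ge0 n P : 0 <= cnt n P.
Proof. exact: pos_INR. Qed.

Lemma cnt_mono n (P Q : seq bool -> Prop) :
  (forall w, w \in words n -> P w -> Q w) -> cnt n P <= cnt n Q.
Proof.
move=> PQ; rewrite /cnt; apply: le_INR; apply/ssrnat.leP.
rewrite -!size_filter; apply: size_subseq_leqif.
elim: (words n) PQ => //= w l IH PQ.
have {}IH := IH (fun v lv => PQ v (mem_behead (s := w :: l) lv)).
case: asboolP => Pw.
  have Qw : Q w by apply: PQ => //; rewrite mem_head.
  by case: asboolP => //= _; rewrite eqxx.
case: asboolP => // _; exact: subseq_trans IH (subseq_cons _ _).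
Qed.

Lemma cnt_le_pow2 n P : cnt n P <= 2 ^ n.
Proof.
elim: n P => [|n IH] P; first by rewrite cnt0 /=; case: `[< _ >]; lra.
rewrite cntS /=.
have := IH (fun w => P (false :: w)); have := IH (fun w => P (true :: w)); lra.
Qed.

Lemma cnt_false n P : (forall w, ~ P w) -> cnt n P = 0.
Proof.
move=> nP; rewrite /cnt (eq_count (a2 := pred0)) ?count_pred0//.
by move=> w /=; apply/asboolP.
Qed.

(** Words of length [n + m] are sorted by their prefix [w]: [F] allows it [B] suffixes and [E]
    allows [K]. In use, [F] means fat and [E] means nonempty. *)
Lemma cnt_cat n m (P E F : seq bool -> Prop) (B K : R) :
  (forall w, w \in words n ->
     cnt m (fun v => P (w ++ v))
     <= (if `[< F w >] then B else 0) + (if `[< E w >] then K else 0)) ->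
  cnt (n + m) P <= B * cnt n F + K * cnt n E.
Proof.
elim: n P E F => [|n IH] P E F H.
  have : cnt m P <= _ := H [::] (mem_head _ _).
  by rewrite !cnt0 add0n; case: `[< F _ >]; case: `[< E _ >]; lra.
rewrite addSn !cntS.
have H0 : forall b w, w \in words n -> b :: w \in words n.+1.
  move=> b w wn; rewrite mem_cat; apply/orP.
  by case: b; [right|left]; apply: map_f.
have := IH (fun w => P (false :: w)) (fun w => E (false :: w))
  (fun w => F (false :: w)) (fun w wn => H (false :: w) (H0 _ _ wn)).
have := IH (fun w => P (true :: w)) (fun w => E (true :: w))
  (fun w => F (true :: w)) (fun w wn => H (true :: w) (H0 _ _ wn)).
lra.
Qed.

(** * Cutting segments along the fold *)

Definition mem_coord (a : R) (z : R * R) : R := a * snd z + (1 - a) * fst z.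

Definition branch (a : R) (i : bool) (z : R * R) : R * R :=
  (snd z, if i then 2 - 2 * mem_coord a z else 2 * mem_coord a z).

Definition side (a : R) (i : bool) (z : R * R) : Prop :=
  if i then 1/2 <= mem_coord a z else mem_coord a z <= 1/2.

(** Both sides include the fold, so that membership survives limits of points, as compactness
    requires; the price is that a point on the fold can carry several words. *)
Fixpoint closed_cyl (a : R) (w : seq bool) (z : R * R) : Prop :=
  square z /\
  if w is i :: v then side a i z /\ closed_cyl a v (branch a i z) else True.

Definition on_seg (p q z : R * R) : Prop :=
  exists t, 0 <= t <= 1 /\
    z = (fst p + t * (fst q - fst p), snd p + t * (snd q - snd p)).

Definition seg_cnt (a : R) (n : nat) (p q : R * R) : R :=
  cnt n (fun w => exists z, on_seg p q z /\ closed_cyl a w z).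

(* The weights make both branches expand by at most 3/2 as soon as a <= 1/4. *)
Definition ext (a : R) (p q : R * R) : R :=
  (2 - 2 * a) * Rabs (fst q - fst p) + 3/2 * Rabs (snd q - snd p).

Lemma mem_coord_seg a p q t :
  mem_coord a (fst p + t * (fst q - fst p), snd p + t * (snd q - snd p))
  = mem_coord a p + t * (mem_coord a q - mem_coord a p).
Proof. rewrite /mem_coord /=; ring. Qed.

Lemma branch_seg a i p q z :
  on_seg p q z -> on_seg (branch a i p) (branch a i q) (branch a i z).
Proof.
move=> [t [t01 ->]]; exists t; split=> //.
by rewrite /branch mem_coord_seg /=; case: i; congr pair; ring.
Qed.

Lemma branch_square a i z :
  0 < a < 1 -> square z -> side a i z -> square (branch a i z).
Proof.
rewrite /square /side /branch /mem_coord => a01 /= [] [x0 x1] [y0 y1] h.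
have : 0 <= a * snd z <= a by nra.
have : 0 <= (1 - a) * fst z <= 1 - a by nra.
by case: i h => h /=; lra.
Qed.

Lemma seg_cnt_sym a n p q : seg_cnt a n p q = seg_cnt a n q p.
Proof.
have H p' q' : seg_cnt a n p' q' <= seg_cnt a n q' p'.
  apply: cnt_mono => w _ [z [[t [t01 ->]] cz]].
  exists (fst p' + t * (fst q' - fst p'), snd p' + t * (snd q' - snd p')).
  by split=> //; exists (1 - t); split; [lra|congr pair; ring].
by apply: Rle_antisym; exact: H.
Qed.

Lemma ext_sym a p q : ext a p q = ext a q p.
Proof.
by rewrite /ext (Rabs_minus_sym (fst q)) (Rabs_minus_sym (snd q)).
Qed.

(** Dropping the first letter [i] amounts to applying branch [i], an affine map that carries the
    part of the segment on side [i] into the image segment. *)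
Lemma seg_cnt_side a n i p q p' q' :
  (forall z, on_seg p q z -> side a i z -> on_seg p' q' z) ->
  cnt n (fun w => exists z, on_seg p q z /\ closed_cyl a (i :: w) z)
  <= seg_cnt a n (branch a i p') (branch a i q').
Proof.
move=> H; apply: cnt_mono => w _ [z [zs [sz [hz cz]]]].
by exists (branch a i z); split=> //; apply/branch_seg/H.
Qed.

Lemma seg_cnt_empty a n i p q :
  (forall z, on_seg p q z -> ~ side a i z) ->
  cnt n (fun w => exists z, on_seg p q z /\ closed_cyl a (i :: w) z) = 0.
Proof. by move=> H; apply: cnt_false => w [z [zs [sz [hz cz]]]]; apply: (H z). Qed.

Lemma seg_cntS a n p q : seg_cnt a n.+1 p q =
  cnt n (fun w => exists z, on_seg p q z /\ closed_cyl a (false :: w) z)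
  + cnt n (fun w => exists z, on_seg p q z /\ closed_cyl a (true :: w) z).
Proof. exact: cntS. Qed.

Lemma convex_pos x y t : 0 < x -> 0 < y -> 0 <= t <= 1 -> 0 < x + t * (y - x).
Proof. by move=> x0 y0 t01; case: (Rle_dec x y) => xy; nra. Qed.

Lemma seg_cnt_left a n p q : mem_coord a p < 1/2 -> mem_coord a q < 1/2 ->
  seg_cnt a n.+1 p q <= seg_cnt a n (branch a false p) (branch a false q).
Proof.
move=> hp hq; rewrite seg_cntS (@seg_cnt_empty _ _ true).
  by have := @seg_cnt_side a n false p q p q (fun z h _ => h); lra.
move=> z [t [t01 ->]]; rewrite /side mem_coord_seg; apply: Rlt_not_le.
have := @convex_pos (1/2 - mem_coord a p) (1/2 - mem_coord a q) t; lra.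
Qed.

Lemma seg_cnt_right a n p q : 1/2 < mem_coord a p -> 1/2 < mem_coord a q ->
  seg_cnt a n.+1 p q <= seg_cnt a n (branch a true p) (branch a true q).
Proof.
move=> hp hq; rewrite seg_cntS (@seg_cnt_empty _ _ false).
  by have := @seg_cnt_side a n true p q p q (fun z h _ => h); lra.
move=> z [t [t01 ->]]; rewrite /side mem_coord_seg; apply: Rlt_not_le.
have := @convex_pos (mem_coord a p - 1/2) (mem_coord a q - 1/2) t; lra.
Qed.

(* A segment inside the fold is kept whole by both branches, so its extent counts twice. *)
Lemma seg_cnt_fold a n p q : mem_coord a p = 1/2 -> mem_coord a q = 1/2 ->
  seg_cnt a n.+1 p q <= 2 * seg_cnt a n (snd p, 1) (snd q, 1).
Proof.
move=> hp hq; rewrite seg_cntS.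
have := @seg_cnt_side a n true p q p q (fun z h _ => h).
have := @seg_cnt_side a n false p q p q (fun z h _ => h).
rewrite /branch hp hq (_ : 2 * (1/2) = 1); last lra.
rewrite (_ : 2 - 1 = 1); lra.
Qed.

(** [mem_coord] is strictly monotone along the segment, so the fold is met in one point [c], which
    belongs to both pieces. The extent is a weighted sum of absolute coordinate differences, hence
    additive along a segment. *)
Lemma seg_cnt_cross a n p q :
  mem_coord a p <= 1/2 <= mem_coord a q -> mem_coord a p < mem_coord a q ->
  exists c, [/\ on_seg p q c, mem_coord a c = 1/2,
    ext a p c + ext a c q = ext a p q &
    seg_cnt a n.+1 p q <= seg_cnt a n (branch a false p) (branch a false c)
                       + seg_cnt a n (branch a true c) (branch a true q)].
Proof.
move=> hpq lt.
set D := mem_coord a q - mem_coord a p; have D0 : 0 < D by rewrite /D; lra.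
have [t tD] : exists t, t * D = 1/2 - mem_coord a p.
  by exists ((1/2 - mem_coord a p) / D); field; lra.
have t01 : 0 <= t <= 1.
  rewrite /D in D0 tD; split; apply: (Rmult_le_reg_r D) => //; rewrite tD /D; lra.
exists (fst p + t * (fst q - fst p), snd p + t * (snd q - snd p)).
have ab c : Rabs (t * c) + Rabs ((1 - t) * c) = Rabs c.
  have [t0 t1] := t01.
  rewrite !Rabs_mult (Rabs_pos_eq t t0) (Rabs_pos_eq (1 - t)); [ring|lra].
split.
- by exists t.
- rewrite mem_coord_seg -/D; lra.
- rewrite /ext /= -(ab (fst q - fst p)) -(ab (snd q - snd p)).
  rewrite (_ : fst p + t * (fst q - fst p) - fst p = t * (fst q - fst p)); last ring.
  rewrite (_ : snd p + t * (snd q - snd p) - snd p = t * (snd q - snd p)); last ring.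
  rewrite (_ : fst q - (fst p + t * (fst q - fst p)) = (1 - t) * (fst q - fst p)); last ring.
  rewrite (_ : snd q - (snd p + t * (snd q - snd p)) = (1 - t) * (snd q - snd p)); last ring.
  ring.
rewrite seg_cntS; apply: Rplus_le_compat; apply: seg_cnt_side.
- move=> z [s [s01 ->]]; rewrite /side mem_coord_seg -/D => h.
  have st : s <= t by nra.
  (* For [t = 0] the left piece is the point [p], and the new parameter [s / t] makes no sense. *)
  case: (Req_dec t 0) => t0.
    have s0 : s = 0 by lra.
    by exists 0; split; [lra|]; rewrite t0 s0 /=; congr pair; ring.
  exists (s / t); split.
    have st0 : s / t * t = s by field.
    by split; nra.
  by rewrite /=; congr pair; field.
- move=> z [s [s01 ->]]; rewrite /side mem_coord_seg -/D => h.
  have st : t <= s by nra.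
  case: (Req_dec t 1) => t1.
    have s1 : s = 1 by lra.
    by exists 0; split; [lra|]; rewrite t1 s1 /=; congr pair; ring.
  exists ((s - t) / (1 - t)); split.
    have st0 : (s - t) / (1 - t) * (1 - t) = s - t by field; lra.
    by split; nra.
  by rewrite /=; congr pair; field; lra.
Qed.

Lemma Rabs_bounds x b : Rabs x <= b -> - b <= x <= b.
Proof. by have := Rle_abs x; have := Rle_abs (- x); rewrite Rabs_Ropp; lra. Qed.

Lemma on_seg_start p q : on_seg p q p.
Proof. by exists 0; split; [lra|]; rewrite [LHS]surjective_pairing; congr pair; ring. Qed.

Lemma on_seg_end p q : on_seg p q q.
Proof. by exists 1; split; [lra|]; rewrite [LHS]surjective_pairing; congr pair; ring. Qed.

Lemma on_seg_sym p q z : on_seg p q z -> on_seg q p z.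
Proof.
move=> [t [t01 ->]]; exists (1 - t); split; first lra.
by congr pair; ring.
Qed.

Lemma square_seg p q z : square p -> square q -> on_seg p q z -> square z.
Proof. by rewrite /square => sp sq [t [t01 ->]] /=; nra. Qed.

Lemma ext_ge0 a p q : a <= 1 -> 0 <= ext a p q.
Proof.
move=> a1; rewrite /ext.
have := Rabs_pos (fst q - fst p); have := Rabs_pos (snd q - snd p); nra.
Qed.

(** The abscissa coefficient grows by exactly 3/2. The height difference reappears as abscissa
    difference, so its coefficient becomes at most (2 - 2a) + 3a = 2 + a, and 2 + a <= 9/4 exactly
    when a <= 1/4. *)
Lemma ext_branch a i p q : 0 < a <= 1/4 ->
  ext a (branch a i p) (branch a i q) <= 3/2 * ext a p q.
Proof.
move=> a01; rewrite /ext /=.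
set X := fst q - fst p; set Y := snd q - snd p.
have -> : Rabs ((if i then 2 - 2 * mem_coord a q else 2 * mem_coord a q) -
    (if i then 2 - 2 * mem_coord a p else 2 * mem_coord a p))
   = Rabs (2 * a * Y + (2 - 2 * a) * X).
  rewrite /mem_coord /X /Y; case: i.
    by rewrite -Rabs_Ropp; congr Rabs; ring.
  by congr Rabs; ring.
have := Rabs_triang (2 * a * Y) ((2 - 2 * a) * X).
rewrite (Rabs_mult _ X) (Rabs_mult _ Y).
rewrite (Rabs_pos_eq (2 * a)); last lra.
rewrite (Rabs_pos_eq (2 - 2 * a)); last lra.
have := Rabs_pos X; have := Rabs_pos Y; nra.
Qed.

(** Keeps a short segment that crosses the fold close to it, which places its images near the top
    edge of the square. *)
Lemma mem_coord_ext a p q : 0 < a <= 1/4 ->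
  Rabs (mem_coord a q - mem_coord a p) <= ext a p q / 2.
Proof.
move=> a01; rewrite /ext.
set X := fst q - fst p; set Y := snd q - snd p.
have -> : mem_coord a q - mem_coord a p = a * Y + (1 - a) * X.
  by rewrite /mem_coord /X /Y; ring.
have := Rabs_triang (a * Y) ((1 - a) * X); rewrite !Rabs_mult.
rewrite (Rabs_pos_eq a); last lra.
rewrite (Rabs_pos_eq (1 - a)); last lra.
have := Rabs_pos X; have := Rabs_pos Y; nra.
Qed.

(** Parallel to the fold the coordinate differences satisfy (1 - a) X = - a Y, so [e] = |Y|
    determines both extents. *)
Lemma ext_fold a p q : 0 < a <= 1/4 -> mem_coord a p = mem_coord a q ->
  exists e, [/\ 0 <= e, ext a p q = (2 * a + 3/2) * e &
     ext a (snd p, 1) (snd q, 1) = (2 - 2 * a) * e].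
Proof.
move=> a01 epq; exists (Rabs (snd q - snd p)).
have key : (1 - a) * (fst q - fst p) = - (a * (snd q - snd p)).
  by move: epq; rewrite /mem_coord; lra.
have : Rabs ((1 - a) * (fst q - fst p)) = Rabs (a * (snd q - snd p)).
  by rewrite key Rabs_Ropp.
rewrite !Rabs_mult.
rewrite (Rabs_pos_eq a); last lra.
rewrite (Rabs_pos_eq (1 - a)); last lra.
move=> E; split; first exact: Rabs_pos.
  by rewrite /ext; lra.
by rewrite /ext /= Rminus_diag Rabs_R0; ring.
Qed.

(** * Growth of the number of cylinders met by a segment *)

Section SegmentGrowth.
Variables (a rho C : R).
Hypothesis a01 : 0 < a < 1/4.
Hypothesis rho32 : 3/2 < rho.
Hypothesis rho2 : rho < 2.
(** Two steps that begin inside the fold cost a factor 2 for the two branches, (2 - 2a)/(2a + 3/2)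
    for the fold step and 3/2 for the next step. *)
Hypothesis rho_fold : 3 * (2 - 2 * a) < rho ^ 2 * (2 * a + 3/2).
Hypothesis C0 : 0 < C.
(** 160 = 16 * 10 and 640 = 32 * 20: for a segment of extent at least 1/10, the term with [C] pays
    for the constant 16 after one cut and for 32 after a fold step and a further cut. *)
Hypothesis C_cross : 160 <= C * (rho - 3/2).
Hypothesis C_fold : 640 <= C * (rho ^ 2 * (2 * a + 3/2) - 3 * (2 - 2 * a)).

(** The constant 8 covers lengths below 4, with at most 2^3 words. A cut doubles it to 16, which two
    steps absorb because 2 < 9/4 <= rho^2. *)
Let bd n p q := seg_cnt a n p q <= rho ^ n * (8 + C * ext a p q).

Let rho_gt0 n : 0 < rho ^ n.
Proof. by apply: pow_lt; lra. Qed.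

Let le_bd n (s t : R) : s <= t -> rho ^ n * (8 + C * s) <= rho ^ n * (8 + C * t).
Proof. by move=> st; apply: Rmult_le_compat_l; [exact/Rlt_le/rho_gt0|nra]. Qed.

Inductive cut_case (n : nat) (p q : R * R) : Prop :=
| NoCut (i : bool) of side a i p & side a i q &
    seg_cnt a n.+1 p q <= seg_cnt a n (branch a i p) (branch a i q)
| Fold of mem_coord a p = 1/2 & mem_coord a q = 1/2
| Cross (i : bool) (c : R * R) of side a i p & side a (~~ i) q & mem_coord a c = 1/2 & on_seg p q c &
    ext a p c + ext a c q = ext a p q &
    seg_cnt a n.+1 p q <= seg_cnt a n (branch a i p) (branch a i c)
                       + seg_cnt a n (branch a (~~ i) c) (branch a (~~ i) q).

Lemma cut_caseP n p q : square p -> square q -> cut_case n p q.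
Proof.
move=> sp sq.
case: (Rtotal_order (mem_coord a p) (1/2)) => [lp|[ep|gp]];
case: (Rtotal_order (mem_coord a q) (1/2)) => [lq|[eq|gq]].
- by apply: (@NoCut _ _ _ false); [rewrite /=; lra ..|exact: seg_cnt_left].
(* An end on the fold is treated as a crossing with a degenerate piece, since closed cylinders of
   both branches may contain it. *)
- have [||c [sc uc ec H]] := @seg_cnt_cross a n p q; [lra..|].
  apply: (@Cross _ _ _ false c) => //=; lra.
- have [||c [sc uc ec H]] := @seg_cnt_cross a n p q; [lra..|].
  apply: (@Cross _ _ _ false c) => //=; lra.
- have [||c [sc uc ec H]] := @seg_cnt_cross a n q p; [lra..|].
  apply: (@Cross _ _ _ true c) => //=; [lra..|exact: on_seg_sym| |].
    by rewrite (ext_sym a p c) (ext_sym a c q) (ext_sym a p q); lra.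
  rewrite (seg_cnt_sym a _ p q) (seg_cnt_sym a n (branch a true p)).
  by rewrite (seg_cnt_sym a n (branch a false c)); lra.
- exact: Fold.
- have [||c [sc uc ec H]] := @seg_cnt_cross a n p q; [lra..|].
  apply: (@Cross _ _ _ false c) => //=; lra.
- have [||c [sc uc ec H]] := @seg_cnt_cross a n q p; [lra..|].
  apply: (@Cross _ _ _ true c) => //=; [lra..|exact: on_seg_sym| |].
    by rewrite (ext_sym a p c) (ext_sym a c q) (ext_sym a p q); lra.
  rewrite (seg_cnt_sym a _ p q) (seg_cnt_sym a n (branch a true p)).
  by rewrite (seg_cnt_sym a n (branch a false c)); lra.
- have [||c [sc uc ec H]] := @seg_cnt_cross a n q p; [lra..|].
  apply: (@Cross _ _ _ true c) => //=; [lra..|exact: on_seg_sym| |].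
    by rewrite (ext_sym a p c) (ext_sym a c q) (ext_sym a p q); lra.
  rewrite (seg_cnt_sym a _ p q) (seg_cnt_sym a n (branch a true p)).
  by rewrite (seg_cnt_sym a n (branch a false c)); lra.
- by apply: (@NoCut _ _ _ true); [rewrite /=; lra ..|exact: seg_cnt_right].
Qed.

Let sqb i z : square z -> side a i z -> square (branch a i z).
Proof. by move=> sz hz; apply: branch_square => //; lra. Qed.

(* A segment that meets the fold twice in a row is then near (1,1) and next near (1,0), both far
   from the fold. *)
Lemma seg_cnt_corner k p q : square p -> square q ->
  9/10 <= fst p -> 9/10 <= fst q -> 17/20 <= snd p -> 17/20 <= snd q ->
  (forall p' q', square p' -> square q' -> bd k p' q') ->
  seg_cnt a k.+2 p q <= rho ^ k * (8 + C * (9/4 * ext a p q)).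
Proof.
move=> sp sq p1 q1 p2 q2 IH.
have up : 17/20 <= mem_coord a p by rewrite /mem_coord; nra.
have uq : 17/20 <= mem_coord a q by rewrite /mem_coord; nra.
have sp' : square (branch a true p) by apply: sqb => //=; lra.
have sq' : square (branch a true q) by apply: sqb => //=; lra.
(* The image has abscissa [snd p] >= 17/20 with weight above 3/4, and 17/20 * 3/4 = 51/80 > 1/2. *)
have up' : 1/2 < mem_coord a (branch a true p).
  rewrite (_ : mem_coord a _ = a * snd (branch a true p) + (1 - a) * snd p) //.
  by case: sp' => _; set y := snd (branch a true p); nra.
have uq' : 1/2 < mem_coord a (branch a true q).
  rewrite (_ : mem_coord a _ = a * snd (branch a true q) + (1 - a) * snd q) //.
  by case: sq' => _; set y := snd (branch a true q); nra.
apply: Rle_trans (@seg_cnt_right a _ p q _ _) _; [lra..|].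
apply: Rle_trans (@seg_cnt_right a _ _ _ up' uq') _.
apply: Rle_trans (IH _ _ _ _) _; [by apply: sqb => //=; lra..|].
apply: le_bd; have := @ext_branch a true p q.
have := @ext_branch a true (branch a true p) (branch a true q); lra.
Qed.

Let two_step n s t : t <= 9/4 * s -> 0 <= s -> rho ^ n * (16 + C * t) <= rho ^ n.+2 * (8 + C * s).
Proof.
move=> ts s0.
have -> : rho ^ n.+2 = rho ^ n * rho ^ 2 by rewrite /=; ring.
rewrite Rmult_assoc; apply: Rmult_le_compat_l; first exact/Rlt_le/rho_gt0.
have r2 : 9/4 <= rho ^ 2 by nra.
have Ct : C * t <= C * (9/4 * s) by apply: Rmult_le_compat_l; lra.
have Cs : 0 <= C * s by nra.
set r := rho ^ 2 in r2 *; nra.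
Qed.

(** Short segments at this height are the images of a cut or folded one. If such a segment is cut
    again, its pieces land near (1,1), and [seg_cnt_corner] grants two uncut steps, which absorb the
    doubling. In every case the bound is the one for a single uncut step. *)
Lemma seg_cnt_top k p q : square p -> square q ->
  9/10 <= snd p -> 9/10 <= snd q -> ext a p q <= 3/20 ->
  (forall m p' q', (m < k.+3)%N -> square p' -> square q' -> bd m p' q') ->
  seg_cnt a k.+3 p q <= rho ^ k.+2 * (8 + C * (3/2 * ext a p q)).
Proof.
move=> sp sq p2 q2 spq IH.
have e0 : 0 <= ext a p q by apply: ext_ge0; lra.
(* Extent 3/20 keeps [mem_coord] within 3/40 of 1/2, hence the image height within 3/20 of 1. *)
have near i z : side a i z -> mem_coord a z - 3/40 <= 1/2 <= mem_coord a z + 3/40 ->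
    17/20 <= snd (branch a i z).
  by case: i => /=; lra.
case: (@cut_caseP k.+2 p q sp sq).
- move=> i hp hq H; apply: Rle_trans H _.
  apply: Rle_trans (IH k.+2 _ _ _ _ _) _ => //; [exact: sqb..|].
  by apply/le_bd/ext_branch; lra.
- move=> up uq; apply: Rle_trans (@seg_cnt_fold _ _ _ _ up uq) _.
  have [|e [e_ge0 e1 e2]] := @ext_fold a p q _ (etrans up (esym uq)); first lra.
  have H : seg_cnt a k.+2 (snd p, 1) (snd q, 1)
      <= rho ^ k * (8 + C * (9/4 * ext a (snd p, 1) (snd q, 1))).
    apply: seg_cnt_corner => //=; try lra; [by move: sp sq; rewrite /square /=; lra..|].
    by move=> p' q'; apply: IH; rewrite ltnS -addn2 leq_addr.
  apply: Rle_trans (Rmult_le_compat_l 2 _ _ _ H) _; first lra.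
  have -> : rho ^ k.+2 = rho ^ k * rho ^ 2 by rewrite /=; ring.
  rewrite e2 e1.
  have r2 : 9/4 <= rho ^ 2 by nra.
  rewrite (_ : 2 * (_ * (_ + C * _)) = rho ^ k * (16 + 3 * (2 - 2 * a) * (3/2 * C * e))); last field.
  rewrite (Rmult_assoc (rho ^ k)); apply: Rmult_le_compat_l; first exact/Rlt_le/rho_gt0.
  have : 0 <= 3/2 * C * e by nra.
  nra.
- move=> i c hp hq uc cs ec H; apply: Rle_trans H _.
  have ep0 : 0 <= ext a p c by apply: ext_ge0; lra.
  have eq0 : 0 <= ext a c q by apply: ext_ge0; lra.
  have hc j : side a j c by rewrite /side; case: j; lra.
  have upc : Rabs (mem_coord a c - mem_coord a p) <= 3/40.
    by apply: Rle_trans (@mem_coord_ext a p c _) _; lra.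
  have ucq : Rabs (mem_coord a q - mem_coord a c) <= 3/40.
    by apply: Rle_trans (@mem_coord_ext a c q _) _; lra.
  move/Rabs_bounds: upc => upc; move/Rabs_bounds: ucq => ucq.
  have yc : 9/10 <= snd c by case: cs => t [t01 ->] /=; nra.
  have sc : square c by exact: square_seg cs.
  have H1 : seg_cnt a k.+2 (branch a i p) (branch a i c) <= 
      rho ^ k * (8 + C * (9/4 * ext a (branch a i p) (branch a i c))).
    apply: seg_cnt_corner => //=; [exact: sqb|exact: sqb|apply: near => //; lra..|].
    by move=> p' q'; apply: IH; rewrite ltnS -addn2 leq_addr.
  have H2 : seg_cnt a k.+2 (branch a (~~ i) c) (branch a (~~ i) q) <= 
      rho ^ k * (8 + C * (9/4 * ext a (branch a (~~ i) c) (branch a (~~ i) q))).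
    apply: seg_cnt_corner => //=; [exact: sqb|exact: sqb|apply: near => //; lra..|].
    by move=> p' q'; apply: IH; rewrite ltnS -addn2 leq_addr.
  apply: Rle_trans (Rplus_le_compat _ _ _ _ H1 H2) _.
  rewrite -Rmult_plus_distr_l.
  rewrite (_ : 8 + _ + _ = 16 + C * (9/4 * (ext a (branch a i p) (branch a i c) +
     ext a (branch a (~~ i) c) (branch a (~~ i) q)))); last field.
  apply: two_step; last by lra.
  have := @ext_branch a i p c; have := @ext_branch a (~~ i) c q; lra.
Qed.

Let base (n : nat) p q : square p -> square q -> (n < 4)%N -> bd n p q.
Proof.
move=> sp sq n4; apply: Rle_trans (@cnt_le_pow2 _ _) _.
have e0 : 0 <= C * ext a p q by apply: Rmult_le_pos; [lra|apply: ext_ge0; lra].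
have : 2 ^ n <= 8 by case: n n4 => [|[|[|[|//]]]] _ /=; lra.
have : 1 ^ n <= rho ^ n by apply: pow_incr; lra.
rewrite pow1; nra.
Qed.

(** Strong induction on [n], according to the first cut. After a cut, a segment of extent below 1/10
    has images of height at least 9/10 and extent at most 3/20, so [seg_cnt_top] applies. For a
    longer one the term [C * ext a p q] pays for a crude count of pieces. *)
Lemma seg_cnt_growth n p q : square p -> square q -> bd n p q.
Proof.
elim/ltn_ind: n p q => n IH p q sp sq.
case: (ltnP n 4) => n4; first exact: base.
case: n n4 IH => [|[|[|[|k]]]] // _ IH.
have e0 : 0 <= ext a p q by apply: ext_ge0; lra.
have rk := rho_gt0 k; have rk2 := rho_gt0 k.+2; have rk3 := rho_gt0 k.+3.
have rE n : rho ^ n.+2 = rho ^ n * rho ^ 2 by rewrite /=; ring.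
rewrite /bd; case: (@cut_caseP k.+3 p q sp sq).
- move=> i hp hq H; apply: Rle_trans H _.
  apply: Rle_trans (IH k.+3 _ _ _ _ _) _ => //; [exact: sqb..|].
  have := @ext_branch a i p q; have -> : rho ^ k.+4 = rho ^ k.+3 * rho by rewrite /=; ring.
  move=> /(_ ltac:(lra)) H; rewrite (Rmult_assoc (rho ^ k.+3)).
  apply: Rmult_le_compat_l; first lra.
  have : C * ext a (branch a i p) (branch a i q) <= C * (3/2 * ext a p q).
    by apply: Rmult_le_compat_l; lra.
  have : 0 <= C * ext a p q by nra.
  nra.
- move=> up uq; apply: Rle_trans (@seg_cnt_fold _ _ _ _ up uq) _.
  have [|e [e_ge0 e1 e2]] := @ext_fold a p q _ (etrans up (esym uq)); first lra.
  have sp' : square (snd p, 1) by move: sp; rewrite /square /=; lra.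
  have sq' : square (snd q, 1) by move: sq; rewrite /square /=; lra.
  rewrite (rE k.+2) Rmult_assoc e1.
  have Ce : 0 <= C * e by nra.
  have r2 : 9/4 <= rho ^ 2 by nra.
  case: (Rlt_le_dec (ext a p q) (1/10)) => small.
    have := @seg_cnt_top k (snd p, 1) (snd q, 1) sp' sq'; rewrite /= e2.
    move=> /(_ ltac:(lra) ltac:(lra)) H.
    apply: Rle_trans (Rmult_le_compat_l 2 _ _ _ (H _ _)) _; [lra|nra| |].
      by move=> m p' q' mk; apply: IH; exact: ltnW.
    rewrite (_ : 2 * (_ * (_ + C * _)) = rho ^ k.+2 * (16 + 3 * (2 - 2 * a) * (C * e)));
      last by rewrite /=; field.
    apply: Rmult_le_compat_l; first lra.
    nra.
  (* A long segment inside the fold may be cut once more after the fold step: two branches times two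
     pieces give the constant 32, paid for because e >= 1/20. *)
  have big : seg_cnt a k.+3 (snd p, 1) (snd q, 1) <= rho ^ k.+2 * (16 + C * (3/2 * ((2 - 2 * a) * e))).
    case: (@cut_caseP k.+2 _ _ sp' sq').
    + move=> i hp hq H; apply: Rle_trans H _.
      apply: Rle_trans (IH k.+2 _ _ _ _ _) _ => //; [exact: sqb..|].
      apply: Rmult_le_compat_l; first lra.
      have := @ext_branch a i (snd p, 1) (snd q, 1); rewrite e2 => /(_ ltac:(lra)) H.
      have := Rmult_le_compat_l C _ _ _ H; lra.
    (* The fold has only one point at height 1, so this segment is a point, which both branches send
       to (1,1). *)
    + move=> up' uq'; have pq : snd q = snd p.
        by move: up' uq'; rewrite /mem_coord /=; nra.
      apply: Rle_trans (_ : _ <= 2 * seg_cnt a k.+2 (1, 1) (1, 1)) _.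
        exact: (@seg_cnt_fold _ _ _ _ up' uq').
      have s11 : square (1, 1) by rewrite /square /=; lra.
      have e11 : ext a (1, 1) (1, 1) = 0 by rewrite /ext /= !Rminus_diag Rabs_R0; ring.
      have := IH k.+2 (leqnSn _) _ _ s11 s11; rewrite /bd e11 => H.
      have de : 0 <= (2 - 2 * a) * e by nra.
      have Cde : 0 <= C * (3 / 2 * ((2 - 2 * a) * e)) by apply: Rmult_le_pos; lra.
      move: H Cde rk2; set r := rho ^ k.+2; set S := seg_cnt _ _ _ _; set X := C * (_ * _).
      by move=> H Cde r0; nra.
    + move=> i c hp hq uc cs ec H; apply: Rle_trans H _.
      have sc : square c by exact: square_seg cs.
      have hc j : side a j c by rewrite /side; case: j; lra.
      have H1 := IH k.+2 (leqnSn _) (branch a i (snd p, 1)) (branch a i c).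
      have H2 := IH k.+2 (leqnSn _) (branch a (~~ i) c) (branch a (~~ i) (snd q, 1)).
      apply: Rle_trans (Rplus_le_compat _ _ _ _ (H1 _ _) (H2 _ _)) _ => //; [exact: sqb..|].
      rewrite -Rmult_plus_distr_l; apply: Rmult_le_compat_l; first lra.
      have E1 := @ext_branch a i (snd p, 1) c ltac:(lra).
      have E2 := @ext_branch a (~~ i) c (snd q, 1) ltac:(lra).
      rewrite (_ : 8 + _ + _ = 16 + C * (ext a (branch a i (snd p, 1)) (branch a i c)
        + ext a (branch a (~~ i) c) (branch a (~~ i) (snd q, 1)))); last ring.
      apply/Rplus_le_compat_l/Rmult_le_compat_l; lra.
  apply: Rle_trans (Rmult_le_compat_l 2 _ _ _ big) _; first lra.
  rewrite (_ : 2 * (_ * (_ + C * _)) = rho ^ k.+2 * (32 + 3 * (2 - 2 * a) * (C * e)));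
      last by rewrite /=; field.
  apply: Rmult_le_compat_l; first lra.
  have e20 : 1/20 <= e by nra.
  have : 32 <= (C * (rho ^ 2 * (2 * a + 3/2) - 3 * (2 - 2 * a))) * e by nra.
  lra.
- move=> i c hp hq uc cs ec H; apply: Rle_trans H _.
  have sc : square c by exact: square_seg cs.
  have hc j : side a j c by rewrite /side; case: j; lra.
  have E1 := @ext_branch a i p c ltac:(lra).
  have E2 := @ext_branch a (~~ i) c q ltac:(lra).
  have ep0 : 0 <= ext a p c by apply: ext_ge0; lra.
  have eq0 : 0 <= ext a c q by apply: ext_ge0; lra.
  have sp' := @sqb _ _ sp hp; have sq' := @sqb _ _ sq hq.
  have sc1 := @sqb _ _ sc (hc i); have sc2 := @sqb _ _ sc (hc (~~ i)).
  case: (Rlt_le_dec (ext a p q) (1/10)) => small.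
    have upc : Rabs (mem_coord a c - mem_coord a p) <= 1/20.
      by apply: Rle_trans (@mem_coord_ext a p c _) _; lra.
    have ucq : Rabs (mem_coord a q - mem_coord a c) <= 1/20.
      by apply: Rle_trans (@mem_coord_ext a c q _) _; lra.
    move/Rabs_bounds: upc => upc; move/Rabs_bounds: ucq => ucq.
    have near j z : side a j z -> mem_coord a z - 1/20 <= 1/2 <= mem_coord a z + 1/20 ->
        9/10 <= snd (branch a j z).
      by case: j => /=; lra.
    have IH' m p' q' : (m < k.+3)%N -> square p' -> square q' -> bd m p' q'.
      by move=> mk; apply: IH; exact: ltnW.
    have H1 := @seg_cnt_top k _ _ sp' sc1 (near _ _ hp _) (near _ _ (hc i) _) _ IH'.
    have H2 := @seg_cnt_top k _ _ sc2 sq' (near _ _ (hc (~~ i)) _) (near _ _ hq _) _ IH'.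
    apply: Rle_trans (Rplus_le_compat _ _ _ _ (H1 _ _ _) (H2 _ _ _)) _; try lra.
    rewrite -Rmult_plus_distr_l.
    rewrite (_ : 8 + _ + _ = 16 + C * (3/2 * (ext a (branch a i p) (branch a i c)
        + ext a (branch a (~~ i) c) (branch a (~~ i) q)))); last field.
    by apply: two_step; lra.
  have H1 := IH k.+3 (leqnn _) _ _ sp' sc1; have H2 := IH k.+3 (leqnn _) _ _ sc2 sq'.
  apply: Rle_trans (Rplus_le_compat _ _ _ _ H1 H2) _.
  have -> : rho ^ k.+4 = rho ^ k.+3 * rho by rewrite /=; ring.
  rewrite -Rmult_plus_distr_l (Rmult_assoc (rho ^ k.+3)); apply: Rmult_le_compat_l; first lra.
  rewrite (_ : 8 + _ + _ = 16 + C * (ext a (branch a i p) (branch a i c)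
        + ext a (branch a (~~ i) c) (branch a (~~ i) q))); last ring.
  have : C * (ext a (branch a i p) (branch a i c)
        + ext a (branch a (~~ i) c) (branch a (~~ i) q)) <= C * (3/2 * ext a p q).
    by apply: Rmult_le_compat_l; lra.
  have : 16 <= (C * (rho - 3/2)) * ext a p q by nra.
  lra.
Qed.
End SegmentGrowth.

Lemma seg_cnt_bound a : 0 < a < 1/4 -> exists rho C, [/\ 1 < rho, rho < 2 - 2 * a, 0 < C &
  forall n p q, square p -> square q -> seg_cnt a n p q <= C * rho ^ n].
Proof.
move=> a01.
(* At rho = 2 - 2a the fold condition has slack (2 - 2a) a (1 - 4a), positive because a < 1/4.
   Lowering rho by a quarter of a (1 - 4a) uses up only part of it. *)
pose r := 2 - 2 * a - a * (1 - 4 * a) / 4.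
have r1 : 3/2 < r by rewrite /r; nra.
have r2 : r < 2 - 2 * a by rewrite /r; nra.
have r3 : 3 * (2 - 2 * a) < r ^ 2 * (2 * a + 3/2).
  have x0 : 0 < a * (1 - 4 * a) by nra.
  have h : (2 - 2 * a) ^ 2 - (2 - 2 * a) * (a * (1 - 4 * a) / 2) <= r ^ 2.
    have -> : r ^ 2 = (2 - 2 * a) ^ 2 - (2 - 2 * a) * (a * (1 - 4 * a) / 2)
        + (a * (1 - 4 * a) / 4) ^ 2 by rewrite /r; field.
    have := pow2_ge_0 (a * (1 - 4 * a) / 4); lra.
  have := Rmult_le_compat_r (2 * a + 3/2) _ _ ltac:(lra) h.
  have : 0 < (2 - 2 * a) * (a * (1 - 4 * a)) * (1/2 - 2 * a) by apply: Rmult_lt_0_compat; nra.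
  have : 0 < (2 - 2 * a) * (a * (1 - 4 * a)) by nra.
  lra.
pose g := r ^ 2 * (2 * a + 3/2) - 3 * (2 - 2 * a).
have g0 : 0 < g by rewrite /g; lra.
have r0 : 0 < r - 3/2 by lra.
pose C := 160 / (r - 3/2) + 640 / g.
have C1 : 0 < 160 / (r - 3/2) by apply: Rdiv_lt_0_compat; lra.
have C2 : 0 < 640 / g by apply: Rdiv_lt_0_compat; lra.
(* A segment in the square has extent at most (2 - 2a) + 3/2 < 4. *)
exists r, (8 + C * 4); split; [lra|lra|rewrite /C; lra|move=> n p q sp sq].
apply: Rle_trans (@seg_cnt_growth a r C _ _ _ _ _ _ _ n p q sp sq) _ => //; try lra.
- by rewrite /C; lra.
- have -> : 160 = 160 / (r - 3/2) * (r - 3/2) by field; lra.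
  by apply: Rmult_le_compat_r; rewrite /C; lra.
- have {1}-> : 640 = 640 / g * g by field; lra.
  by apply: Rmult_le_compat_r; rewrite /C; lra.
rewrite Rmult_comm; apply: Rmult_le_compat_r; first by apply: pow_le; lra.
apply/Rplus_le_compat_l/Rmult_le_compat_l; first by rewrite /C; lra.
rewrite /ext; case: sp => [] [? ?] [? ?]; case: sq => [] [? ?] [? ?].
have : Rabs (fst q - fst p) <= 1 by apply: Rabs_le; lra.
have : Rabs (snd q - snd p) <= 1 by apply: Rabs_le; lra.
have := Rabs_pos (fst q - fst p); nra.
Qed.

Set Implicit Arguments.
Unset Strict Implicit.

(** * Ultralimits and almost flat families *)

Lemma ultrafilter_nat : exists U : (nat -> Prop) -> Prop,
  [/\ forall A B : nat -> Prop, (forall n, A n -> B n) -> U A -> U B,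
      forall A B : nat -> Prop, U A -> U B -> U (fun n => A n /\ B n),
      ~ U (fun _ => False),
      forall A : nat -> Prop, U A \/ U (fun n => ~ A n) &
      forall m, U (fun n => (m <= n)%N)].
Proof.
have [U [UU ooU]] := ultraFilterLemma (F := \oo%classic) _.
exists U; split.
- by move=> A B AB; apply: filterS.
- by move=> A B; apply: filterI.
- exact: filter_not_empty.
- by move=> A; apply: in_ultra_setVsetC.
- by move=> m; apply: ooU; exists m.
Qed.

Section Ultralimit.
Variable U : (nat -> Prop) -> Prop.
Hypothesis U_mono : forall A B : nat -> Prop, (forall n, A n -> B n) -> U A -> U B.
Hypothesis U_and : forall A B : nat -> Prop, U A -> U B -> U (fun n => A n /\ B n).
Hypothesis U_proper : ~ U (fun _ => False).
Hypothesis U_max : forall A : nat -> Prop, U A \/ U (fun n => ~ A n).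
Hypothesis U_tail : forall m, U (fun n => (m <= n)%N).

Lemma U_all (A : nat -> Prop) : (forall n, A n) -> U A.
Proof. by move=> HA; apply: U_mono (U_tail 0) => n _. Qed.

Lemma U_ex (A : nat -> Prop) : U A -> exists n, A n.
Proof.
move=> UA; apply: contrapT => nA; apply: U_proper.
by apply: U_mono UA => n An; apply: nA; exists n.
Qed.

Definition ulim (f : nat -> R) (l : R) :=
  forall e, 0 < e -> U (fun n => Rabs (f n - l) < e).

(** The limit is the supremum of the levels that [f] reaches on a set in [U]; maximality of [U]
    decides the comparisons with [l - e] and [l + e]. *)
Lemma ulim_exists f (b c : R) : U (fun n => b <= f n <= c) -> exists l, ulim f l.
Proof.
move=> Uf; pose E x := U (fun n => x <= f n).
have [||l [ubl lubl]] := completeness E.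
- exists c => x Ex; have [n [? ?]] := U_ex (U_and Ex Uf); lra.
- by exists b; apply: U_mono Uf => n; lra.
exists l => e e0.
have H1 : U (fun n => l - e < f n).
  case: (U_max (fun n => l - e < f n)) => // H.
  have : is_upper_bound E (l - e).
    by move=> x Ex; have [n [? ?]] := U_ex (U_and Ex H); lra.
  by move/lubl; lra.
have H2 : U (fun n => f n < l + e).
  case: (U_max (fun n => f n < l + e)) => // H.
  have : E (l + e) by apply: U_mono H => n; lra.
  by move/ubl; lra.
by apply: U_mono (U_and H1 H2) => n h; apply: Rabs_def1; lra.
Qed.

Lemma ulim_le f l c : ulim f l -> U (fun n => f n <= c) -> l <= c.
Proof.
move=> fl Uc; apply: Rnot_lt_le => cl.
have [|n [h1 h2]] := U_ex (U_and (fl (l - c) _) Uc); first lra.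
by move: h1 => /Rabs_def2; lra.
Qed.

Lemma ulim_ext f g l : U (fun n => f n = g n) -> ulim f l -> ulim g l.
Proof.
move=> fg fl e e0; apply: U_mono (U_and fg (fl e e0)) => n [<-] //.
Qed.

Lemma ulim_const c : ulim (fun _ => c) c.
Proof. by move=> e e0; apply: U_all => n; rewrite Rminus_diag Rabs_R0. Qed.

Lemma ulim_add f g l m : ulim f l -> ulim g m -> ulim (fun n => f n + g n) (l + m).
Proof.
move=> fl gm e e0.
have [e2 e4] : 0 < e / 2 /\ e = e / 2 + e / 2 by split; [lra|field].
apply: U_mono (U_and (fl _ e2) (gm _ e2)) => n [/Rabs_def2 h1 /Rabs_def2 h2].
by apply: Rabs_def1; lra.
Qed.

Lemma ulim_scale f l c : ulim f l -> ulim (fun n => c * f n) (c * l).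
Proof.
move=> fl e e0; have c0 := Rabs_pos c.
have e1 : 0 < e / (Rabs c + 1) by apply: Rdiv_lt_0_compat; lra.
apply: U_mono (fl _ e1) => n h.
rewrite -Rmult_minus_distr_l Rabs_mult.
have E : e / (Rabs c + 1) * (Rabs c + 1) = e by field; lra.
have := Rabs_pos (f n - l); nra.
Qed.

Lemma ulim_mul f g l m : ulim f l -> ulim g m -> ulim (fun n => f n * g n) (l * m).
Proof.
move=> fl gm.
have f0 : ulim (fun n => (f n - l) * (g n - m)) 0.
  move=> e e0; have [d0 d1] : 0 < Rmin e 1 /\ Rmin e 1 <= 1.
    by split; [apply: Rmin_glb_lt; lra|exact: Rmin_r].
  have de := Rmin_l e 1.
  apply: U_mono (U_and (fl _ d0) (gm _ d0)) => n [h1 h2].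
  rewrite Rminus_0_r Rabs_mult.
  have := Rabs_pos (f n - l); have := Rabs_pos (g n - m); nra.
have H := ulim_add (ulim_add (ulim_scale l gm) (ulim_scale m fl)) (ulim_add f0 (ulim_const (- (l * m)))).
rewrite (_ : l * m = l * m + m * l + (0 + - (l * m))); last ring.
by apply: ulim_ext H; apply: U_all => n; ring.
Qed.

Lemma ulim_unique f l m : ulim f l -> ulim f m -> l = m.
Proof.
move=> fl fm; apply: cond_eq => e e0.
have e2 : 0 < e / 2 by lra.
have [n [/Rabs_def2 h1 /Rabs_def2 h2]] := U_ex (U_and (fl _ e2) (fm _ e2)).
by apply: Rabs_def1; lra.
Qed.

Definition ulim2 (p : nat -> R * R) (z : R * R) :=
  ulim (fun n => fst (p n)) (fst z) /\ ulim (fun n => snd (p n)) (snd z).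

Lemma ulim_opp f l : ulim f l -> ulim (fun n => - f n) (- l).
Proof.
move=> fl; rewrite (_ : - l = -1 * l); last ring.
by apply: ulim_ext (ulim_scale (-1) fl); apply: U_all => n; ring.
Qed.

Lemma ulim_ge f l c : ulim f l -> U (fun n => c <= f n) -> c <= l.
Proof.
move=> /ulim_opp/(@ulim_le _ _ (- c)) H Uc.
have : - l <= - c by apply: H; apply: U_mono Uc => n; lra.
lra.
Qed.

Lemma ulim_mem_coord a p z : ulim2 p z ->
  ulim (fun n => mem_coord a (p n)) (mem_coord a z).
Proof. by move=> [p1 p2]; apply: ulim_add; apply: ulim_scale. Qed.

Lemma ulim_branch a i p z : ulim2 p z ->
  ulim2 (fun n => branch a i (p n)) (branch a i z).
Proof.
move=> pz; split; first by case: pz.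
have u2 := ulim_scale 2 (ulim_mem_coord a pz).
case: i => //=; exact: ulim_add (ulim_const 2) (ulim_opp u2).
Qed.

Lemma ulim_closed_cyl a w p z : ulim2 p z ->
  U (fun n => closed_cyl a w (p n)) -> closed_cyl a w z.
Proof.
elim: w p z => [|i w IH] p z pz Uw.
  split=> //; case: (pz) => p1 p2; split; split.
  - by apply: ulim_ge p1 _; apply: U_mono Uw => n [[[]]].
  - by apply: ulim_le p1 _; apply: U_mono Uw => n [[[]]].
  - by apply: ulim_ge p2 _; apply: U_mono Uw => n [[_ []]].
  - by apply: ulim_le p2 _; apply: U_mono Uw => n [[_ []]].
split; [|split].
- case: (pz) => p1 p2; split; split.
  - by apply: ulim_ge p1 _; apply: U_mono Uw => n [[[]]].
  - by apply: ulim_le p1 _; apply: U_mono Uw => n [[[]]].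
  - by apply: ulim_ge p2 _; apply: U_mono Uw => n [[_ []]].
  - by apply: ulim_le p2 _; apply: U_mono Uw => n [[_ []]].
- have um := ulim_mem_coord a pz.
  have : U (fun n => side a i (p n)) by apply: U_mono Uw => n [_ []].
  by case: i {Uw} => Us; [apply: ulim_ge um Us|apply: ulim_le um Us].
- apply: IH (ulim_branch a i pz) _.
  by apply: U_mono Uw => n [_ []].
Qed.

(** The ultrafilter decides each [x] separately, and finitely many decisions hold together on a set
    in [U]. This lets a count over a finite list pass to the limit. *)
Lemma U_list (T : eqType) (s : seq T) (P : nat -> T -> Prop) :
  U (fun n => forall x, x \in s -> (P n x <-> U (fun n => P n x))).
Proof.
elim: s => [|x s IH]; first by apply: U_all.
have H : U (fun n => P n x <-> U (fun n => P n x)).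
  case: (U_max (fun n => P n x)) => H; first by apply: U_mono (H) => n.
  apply: U_mono (H) => n nP; split=> // H'; exfalso.
  by have [k []] := U_ex (U_and H H').
apply: U_mono (U_and H IH) => n [Hx Hs] y; rewrite inE => /orP[/eqP ->//|ys].
exact: Hs.
Qed.

End Ultralimit.

(** Twice the signed area of the triangle [p q r]. *)
Definition det3 (p q r : R * R) : R :=
  (fst q - fst p) * (snd r - snd p) - (snd q - snd p) * (fst r - fst p).

Lemma det3_eq0_line (p q c : R * R) : det3 p q c = 0 -> p <> q ->
  exists t, c = (fst p + t * (fst q - fst p), snd p + t * (snd q - snd p)).
Proof.
move=> D npq.
case: (Req_dec (fst q) (fst p)) => x0; last first.
  exists ((fst c - fst p) / (fst q - fst p)); rewrite [LHS]surjective_pairing; congr pair.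
    by field; lra.
  apply: (Rmult_eq_reg_l (fst q - fst p)); last lra.
  rewrite (_ : _ * (snd p + _) = (fst q - fst p) * snd p + (fst c - fst p) * (snd q - snd p)).
    by move: D; rewrite /det3; lra.
  by field; lra.
have y0 : snd q <> snd p.
  by move=> y0; apply: npq; rewrite [p]surjective_pairing [q]surjective_pairing x0 y0.
exists ((snd c - snd p) / (snd q - snd p)); rewrite [LHS]surjective_pairing; congr pair.
  move: D; rewrite /det3 x0 => D; have : fst c - fst p = 0.
    by apply: (Rmult_eq_reg_l (snd q - snd p)); lra.
  lra.
by field; lra.
Qed.

(** Induction on the list. When the current ends differ, the new point [c] has a parameter [t] on
    their line, and replaces [p] if t < 0, [q] if t > 1 and neither end otherwise. *)
Lemma collinear_on_seg (s : seq (R * R)) : s != [::] ->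
  (forall p q r, p \in s -> q \in s -> r \in s -> det3 p q r = 0) ->
  exists p q, [/\ p \in s, q \in s & forall z, z \in s -> on_seg p q z].
Proof.
elim: s => // c s IH _ H.
case: (eqVneq s [::]) => [->|s0].
  exists c, c; rewrite mem_head; split=> // z; rewrite inE => /eqP ->.
  exact: on_seg_start.
have [|p [q [ps qs pq]]] := IH s0.
  by move=> x y z xs ys zs; apply: H; rewrite inE ?xs ?ys ?zs orbT.
have pS : p \in c :: s by rewrite inE ps orbT.
have qS : q \in c :: s by rewrite inE qs orbT.
have cS : c \in c :: s := mem_head _ _.
have D := H _ _ _ pS qS cS.
case: (pselect (p = q)) => [epq|npq].
  exists p, c; split=> // z; rewrite inE => /orP[/eqP ->|/pq]; first exact: on_seg_end.
  rewrite -epq => -[t [_ ->]]; exists 0; split; first lra.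
  by congr pair; ring.
have [t ct] := det3_eq0_line D npq.
case: (Rlt_le_dec t 0) => t0.
  exists c, q; split=> // z; rewrite inE => /orP[/eqP ->|/pq [u [u01 ->]]].
    exact: on_seg_start.
  exists ((u - t) / (1 - t)).
  have E : (u - t) / (1 - t) * (1 - t) = u - t by field; lra.
  split; first by split; nra.
  by rewrite ct /=; congr pair; field; lra.
case: (Rle_lt_dec t 1) => t1.
  exists p, q; split=> // z; rewrite inE => /orP[/eqP ->|/pq//].
  by exists t.
exists p, c; split=> // z; rewrite inE => /orP[/eqP ->|/pq [u [u01 ->]]].
  exact: on_seg_end.
exists (u / t).
have E : u / t * t = u by field; lra.
split; first by split; nra.
by rewrite ct /=; congr pair; field; lra.
Qed.

Lemma closed_cyl_square a w z : closed_cyl a w z -> square z.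
Proof. by case: w => [|i w] []. Qed.

(* Compactness: otherwise an ultralimit of counterexamples with ever flatter triangles would be a
   family of points of a segment meeting too many closed cylinders. *)
Lemma flat_family_bound a N K : 0 <= K ->
  (forall p q, square p -> square q -> seg_cnt a N p q <= K) ->
  exists2 eta, 0 < eta & forall (P : seq bool -> Prop) (p : seq bool -> R * R),
    (forall w, P w -> closed_cyl a w (p w)) ->
    (forall u v w, P u -> P v -> P w -> Rabs (det3 (p u) (p v) (p w)) < eta) ->
    cnt N P <= K.
Proof.
move=> K0 segK; apply: contrapT => nH.
(* One counterexample for each eta = 1/(k + 1), so that all determinants vanish in the limit. *)
have bad (k : nat) : exists Pp : (seq bool -> Prop) * (seq bool -> R * R),
    [/\ forall w, Pp.1 w -> closed_cyl a w (Pp.2 w),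
      forall u v w, Pp.1 u -> Pp.1 v -> Pp.1 w ->
        Rabs (det3 (Pp.2 u) (Pp.2 v) (Pp.2 w)) < / (INR k + 1)
      & K < cnt N Pp.1].
  apply: contrapT => nb; apply: nH; exists (/ (INR k + 1)).
    by apply: Rinv_0_lt_compat; have := pos_INR k; lra.
  move=> P p Pp Pd; apply: Rnot_lt_le => KP; apply: nb; by exists (P, p).
have /choice [F HF] := bad.
have [U [U1 U2 U3 U4 U5]] := ultrafilter_nat.
pose P w := U (fun k => (F k).1 w).
have lim w : exists z, P w -> ulim2 U (fun k => (F k).2 w) z.
  case: (pselect (P w)) => Pw; last by exists (0, 0).
  have sq : U (fun k => square ((F k).2 w)).
    apply: (U1) Pw => k Fw; have [H _ _] := HF k.
    exact: closed_cyl_square (H _ Fw).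
  have [|x xl] := @ulim_exists U U1 U2 U3 U4 (fun k => fst ((F k).2 w)) 0 1.
    by apply: (U1) sq => k [].
  have [|y yl] := @ulim_exists U U1 U2 U3 U4 (fun k => snd ((F k).2 w)) 0 1.
    by apply: (U1) sq => k [].
  by exists (x, y).
have /choice [z zP] := lim.
have zc w : P w -> closed_cyl a w (z w).
  move=> Pw; apply: (@ulim_closed_cyl U U1 U2 U3 U5) (zP _ Pw) _.
  by apply: (U1) Pw => k; have [H _ _] := HF k; exact: H.
have zd u v w : P u -> P v -> P w -> det3 (z u) (z v) (z w) = 0.
  move=> Pu Pv Pw; have [u1 u2] := zP _ Pu; have [v1 v2] := zP _ Pv; have [w1 w2] := zP _ Pw.
  have lsub f g l m : ulim U f l -> ulim U g m -> ulim U (fun n => f n - g n) (l - m).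
    by move=> fl /(@ulim_opp U U1 U2 U5) gm; apply: (@ulim_add U U1 U2).
  have dl : ulim U (fun k => det3 ((F k).2 u) ((F k).2 v) ((F k).2 w)) (det3 (z u) (z v) (z w)).
    by apply: (lsub); apply: (@ulim_mul U U1 U2 U5); apply: (lsub).
  apply: (@ulim_unique U U1 U2 U3) dl _ => e e0.
  have [m me] := archimed_cor1 e e0.
  apply: (U1) (U2 _ _ (U2 _ _ Pu Pv) (U2 _ _ Pw (U5 m))) => k [[Fu Fv] [Fw mk]].
  rewrite Rminus_0_r; have [_ H _] := HF k.
  apply: Rlt_trans (H _ _ _ Fu Fv Fw) _; case: me => me m0.
  apply: Rle_lt_trans me; apply: Rinv_le_contravar; first exact: lt_0_INR.
  have : INR m <= INR k by apply: le_INR; apply/ssrnat.leP.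
  lra.
(* On the finite list [words N] the index set of some counterexample agrees with the limit set [P],
   so the count above [K] carries over to [P]. *)
have [k Hk] := U_ex U1 U3 (@U_list U U1 U2 U3 U4 U5 _ (words N) (fun k w => (F k).1 w)).
have [_ _ KF] := HF k.
have KP : K < cnt N P.
  by apply: Rlt_le_trans KF _; apply: cnt_mono => w wN /(Hk w wN).
pose s := [seq z w | w <- words N & `[< P w >]].
have sP x : x \in s -> exists w, [/\ w \in words N, P w & x = z w].
  by case/mapP => w; rewrite mem_filter => /andP[/asboolP Pw wN] ->; exists w.
have [||p [q [ps qs pq]]] := @collinear_on_seg s.
- apply/eqP => s0; have : cnt N P = 0.
    rewrite /cnt -size_filter -(size_map z) -/s s0 //.
  lra.
- by move=> x y t /sP[u [_ Pu ->]] /sP[v [_ Pv ->]] /sP[w [_ Pw ->]]; apply: zd.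
have sq x : x \in s -> square x by move=> /sP[w [_ Pw ->]]; apply: closed_cyl_square (zc _ Pw).
have : cnt N P <= seg_cnt a N p q.
  apply: cnt_mono => w wN Pw; exists (z w); split; last exact: zc.
  by apply: pq; apply/mapP; exists w => //; rewrite mem_filter wN andbT; apply/asboolP.
have := segK _ _ (sq _ ps) (sq _ qs); lra.
Qed.

(** * Area *)

Section AffinePreimage.
Local Open Scope classical_set_scope.
Local Open Scope ring_scope.
Local Open Scope ereal_scope.
Context {R : realType}.
Notation leb := (@lebesgue_measure R).
Notation RM := (measurableTypeR R).

Lemma measurable_affine (k l : R) : measurable_fun setT (fun x : RM => (k * x + l)%R : RM).
Proof.
apply: continuous_measurable_fun => x; apply: cvgD; last exact: cvg_cst.
by apply: cvgM; [exact: cvg_cst|exact: cvg_id].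
Qed.

(** By uniqueness of Lebesgue measure: [k] times its pushforward under x -> kx + l gives half-open
    intervals their length. *)
Lemma lebesgue_measure_affine_pos (k l : R) (B : set RM) : (0 < k)%R -> measurable B ->
  k%:E * leb ((fun x => (k * x + l)%R) @^-1` B) = leb B.
Proof.
move=> k0 mB.
pose f := (fun x : RM => (k * x + l)%R : RM).
apply/esym.
apply: (@lebesgue_measure_unique R (mscale (NngNum (ltW k0)) (pushforward leb f))) => //.
  exact: measurable_affine.
move=> mf _ [[u v]] _ <-.
have fuv : f @^-1` `]u, v]%classic = `]((u - l) / k)%R, ((v - l) / k)%R]%classic.
  by apply/seteqP; split=> x /=; rewrite !in_itv /= /f ltr_pdivrMr// ler_pdivlMr// ltrBlDr lerBrDr mulrC.
change (leb `]u, v]%classic = k%:E * leb (f @^-1` `]u, v]%classic)).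
rewrite fuv.
rewrite !lebesgue_measure_itv /= !lte_fin ltr_pM2r ?invr_gt0// ltrD2r.
case: ifP => uv; last by rewrite mule0.
by rewrite -!EFinB -EFinM -mulrBl opprB addrA subrK mulrC divfK ?gt_eqF.
Qed.

Lemma lebesgue_measure_affine_neg (k l : R) (B : set RM) : (0 < k)%R -> measurable B ->
  k%:E * leb ((fun x => (l - k * x)%R) @^-1` B) = leb B.
Proof.
move=> k0 mB.
have mNB : measurable ((-%R : RM -> RM) @^-1` B).
  by rewrite -[X in measurable X]setTI; exact: (oppr_measurable measurableT).
rewrite -[RHS]lebesgue_measureN// /pushforward -[RHS](lebesgue_measure_affine_pos (- l) k0)//.
congr (_ * leb _); apply/seteqP.
by split=> x /=; rewrite opprD opprK addrC.
Qed.

(* The sections along the first coordinate are affine preimages of slope k; integrate over them. *)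
Lemma product_lebesgue_affine (k : R) (g : R -> R -> R) (X : set (RM * RM)) :
  (0 < k)%R ->
  (forall (y : R) (B : set RM), measurable B -> k%:E * leb ((fun x => g x y) @^-1` B) = leb B) ->
  measurable X -> measurable ((fun z : RM * RM => (z.2, g z.1 z.2) : RM * RM) @^-1` X) ->
  k%:E * (leb \x leb) ((fun z : RM * RM => (z.2, g z.1 z.2) : RM * RM) @^-1` X)
  = (leb \x leb) X.
Proof.
move=> k0 gk mX mgX.
(* The slice of the preimage at second coordinate y is the preimage under x -> g x y of the slice of
   [X] at first coordinate y, so the left side is integrated in the other order. *)
rewrite (@product_measure_unique _ _ RM RM R leb leb (leb \x^ leb))//; last first.
  by move=> A B mA mB; exact: product_measure2E.
rewrite /product_measure2 /product_measure1 -ge0_integralZl_EFin//.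
- apply: eq_integral => y _.
  transitivity (leb (xsection X y)) => //.
  rewrite -(gk y _ (measurable_xsection _ mX)); congr (_ * leb _).
- exact: measurable_fun_ysection.
- exact: ltW.
Qed.
End AffinePreimage.

Local Open Scope classical_set_scope.
Local Open Scope R_scope.

Definition plane : Type := (measurableTypeR R * measurableTypeR R)%type.

Definition leb2 : {measure set plane -> \bar R}%R :=
  (@lebesgue_measure R \x @lebesgue_measure R)%E.

(** Bundles measurability with finiteness of the area, so that later estimates take place in [R]
    instead of the extended reals. *)
Definition has_area (A : R * R -> Prop) (r : R) : Prop :=
  measurable (A : set plane) /\ leb2 (A : set plane) = r%:E.

Lemma has_area_ext A B r : (forall z, A z <-> B z) -> has_area A r -> has_area B r.
Proof. by move=> AB; have -> : A = B by apply/funext => z; apply/propext. Qed.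

Lemma rect_setX a b c d :
  rect a b c d = `[a, b]%classic `*` `[c, d]%classic :> set plane.
Proof.
apply/seteqP; split=> -[x y]; rewrite /rect /= !in_itv /=.
  by move=> [[? ?] [? ?]]; split; apply/andP; split; apply/RleP.
by move=> [/andP[/RleP ? /RleP ?] /andP[/RleP ? /RleP ?]].
Qed.

Lemma measurable_rect a b c d : measurable (rect a b c d : set plane).
Proof. by rewrite rect_setX; apply: measurableX; exact: measurable_itv. Qed.

Lemma itv_length (a b : R) : a <= b ->
  @lebesgue_measure R `[a, b]%classic = (b - a)%:E.
Proof.
move=> ab; rewrite lebesgue_measure_itv /= lte_fin.
case: ifP => [_|/negbT]; first by [].
rewrite -leNgt => /RleP ba.
have -> : b = a by lra.
by congr EFin; symmetry; exact: Rplus_opp_r.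
Qed.

Lemma has_area_rect a b c d : a <= b -> c <= d ->
  has_area (rect a b c d) ((b - a) * (d - c)).
Proof.
move=> ab cd; split; first exact: measurable_rect.
rewrite rect_setX /leb2 /= product_measure1E; [|exact: measurable_itv..].
by rewrite EFinM; congr (_ * _)%E; exact: itv_length.
Qed.

Lemma has_area_ge0 A r : has_area A r -> 0 <= r.
Proof.
move=> [_ Ar]; apply/RleP; rewrite -lee_fin -Ar.
exact: (measure_ge0 leb2).
Qed.

Lemma has_area_mono A B r s :
  has_area A r -> has_area B s -> (forall z, A z -> B z) -> r <= s.
Proof.
move=> [mA Ar] [mB Bs] AB; apply/RleP; rewrite -lee_fin -Ar -Bs.
by apply: le_measure => //; rewrite inE.
Qed.

Lemma has_area_sub A B r : measurable (A : set plane) -> has_area B r ->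
  (forall z, A z -> B z) -> exists s, has_area A s.
Proof.
move=> mA [mB Br] AB; exists (fine (leb2 (A : set plane))); split=> //.
rewrite fineK// ge0_fin_numE; last exact: (measure_ge0 leb2).
apply: (@le_lt_trans _ _ (leb2 (B : set plane))); last by rewrite Br ltry.
by apply: le_measure => //; rewrite inE.
Qed.

Lemma has_area_disjU A B r s : has_area A r -> has_area B s ->
  (forall z, A z -> B z -> False) -> has_area (fun z => A z \/ B z) (r + s).
Proof.
move=> [mA Ar] [mB Bs] AB; split; first exact: measurableU.
rewrite (measureU leb2 mA mB); last first.
  by apply/seteqP; split=> z // [Az Bz]; apply: (AB z).
by rewrite EFinD; congr (_ + _)%E.
Qed.

Lemma has_area_U A B r s : has_area A r -> has_area B s ->
  exists2 t, has_area (fun z => A z \/ B z) t & t <= r + s.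
Proof.
move=> hA hB.
have mBA : measurable ((B : set plane) `\` A).
  by apply: measurableD; [case: hB|case: hA].
have [t ht] := has_area_sub mBA hB (fun z => @proj1 _ _).
exists (r + t); last first.
  by apply: Rplus_le_compat_l; apply: has_area_mono ht hB _ => z [].
apply: has_area_ext (has_area_disjU hA ht _); last by move=> z Az [].
move=> z; split=> [[|[]]|[]]; [by left|by right|by left|move=> Bz].
by case: (pselect (A z)) => Az; [left|right; split].
Qed.

Lemma has_area0 : has_area (fun _ => False) 0.
Proof. by split; [exact: measurable0|exact: measure0]. Qed.

Lemma has_area_sigma (A : nat -> R * R -> Prop) (r : nat -> R) (s : R) :
  (forall n, has_area (A n) (r n)) -> has_area (fun z => exists n, A n z) s ->
  (forall m n z, m <> n -> A m z -> A n z -> False) ->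
  Un_cv (fun N => sum_f_R0 r N) s.
Proof.
move=> hA [mU Us] dA.
have UE : (fun z => exists n, A n z) = \bigcup_n (A n : set plane).
  by apply/seteqP; split=> z [n]; [exists n|move=> _; exists n].
have := @measure_semi_sigma_additive _ _ _ leb2 (A : nat -> set plane).
move=> /(_ (fun n => (hA n).1)) H.
have tA : trivIset setT (A : nat -> set plane).
  apply/trivIsetP => i j _ _ ij; apply/seteqP; split=> z // [Ai Aj].
  by apply: (dA i j z) => //; apply/eqP.
have mU' : measurable (\bigcup_n (A n : set plane)) by rewrite -UE.
have {H} := H tA mU'.
rewrite -UE; rewrite [X in _ --> X]Us.
rewrite (_ : (fun n => _) = (fun n => (\sum_(0 <= i < n) r i)%R%:E)); last first.
  apply/funext => n; rewrite -sumEFin; apply: eq_bigr => i _.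
  exact: (hA i).2.
move=> /fine_cvgP[_ /cvgrPdist_lt H] e /RltP e0.
have [N _ HN] := H e e0.
exists N => n /ssrnat.leP Nn.
(* [sum_f_R0 r n] has n + 1 terms, hence the index [n.+1]. *)
have := HN n.+1 (leqW Nn); rewrite /= -sum_f_R0E -RdistE Rdist_sym => /RltP.
by [].
Qed.

(** Countable subadditivity over the covering rectangles bounds the area by every positive
    number. *)
Lemma null_area A : measurable (A : set plane) -> lebesgue_null A -> has_area A 0.
Proof.
move=> mA nA; split=> //; apply/eqP; rewrite eq_le.
rewrite (measure_ge0 leb2) andbT.
apply/lee_addgt0Pr => e e0; rewrite add0e.
have /RltP e0' := e0; have [a [b [c [d [abcd [cov sum]]]]]] := nA e e0'.
have := @measure_sigma_subadditive _ _ _ leb2 A (fun n => rect (a n) (b n) (c n) (d n)).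
move=> /(_ (fun n => measurable_rect _ _ _ _) mA).
have sub : (A : set plane) `<=` \bigcup_n rect (a n) (b n) (c n) (d n).
  by move=> z /cov[n ?]; exists n.
move=> /(_ sub) /le_trans; apply.
apply: lime_le; first by apply: is_cvg_nneseries => *; exact: measure_ge0.
apply: nearW => n.
rewrite (eq_bigr (fun n => ((b n - a n) * (d n - c n))%:E)); last first.
  by move=> i _; have [ab cd] := abcd i; exact: (has_area_rect ab cd).2.
rewrite sumEFin lee_fin; case: n => [|n]; first by rewrite big_nil ltW.
by rewrite -sum_f_R0E; apply/RleP; exact: sum.
Qed.

Lemma borel_measurable A : borel A -> measurable (A : set plane) /\ (forall z, A z -> square z).
Proof.
have msq : measurable (square : set plane) by exact: (measurable_rect 0 1 0 1).
elim=> [a b c d|B _ [mB _]|B _ IH].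
- split; last by move=> z [].
  exact: (measurableI _ _ msq (measurable_rect a b c d)).
- split; last by move=> z [].
  exact: (measurableI _ _ msq (measurableC mB)).
- split; last by move=> z [n /(proj2 (IH n))].
  rewrite (_ : (fun z => _) = \bigcup_n (B n : set plane)).
    by apply: bigcup_measurable => n _; case: (IH n).
  by apply/seteqP; split=> z [n]; [exists n|move=> _; exists n].
Qed.

Lemma measurable_mem_coord a : measurable_fun setT (mem_coord a : plane -> measurableTypeR R).
Proof.
apply: (@measurable_funD _ plane R setT (fun z => a * snd z) (fun z => (1 - a) * fst z)).
  by apply: (@measurable_funM _ plane R setT (fun _ => a) snd).
by apply: (@measurable_funM _ plane R setT (fun _ => 1 - a) fst).
Qed.

Lemma measurable_branch a i : measurable_fun setT (branch a i : plane -> plane).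
Proof.
have m2 : measurable_fun setT (fun z : plane => 2 * mem_coord a z : measurableTypeR R).
  apply: (@measurable_funM _ plane R setT (fun _ => 2) (mem_coord a)) => //.
  exact: measurable_mem_coord.
apply: measurable_fun_pair; first exact: measurable_snd.
case: i => //.
exact: (@measurable_funB _ plane R setT (fun _ => 2) (fun z => 2 * mem_coord a z)).
Qed.

Lemma measurable_branch_preimage a i A : measurable (A : set plane) ->
  measurable ((fun z => A (branch a i z)) : set plane).
Proof. by move=> mA; rewrite -[X in measurable X]setTI; exact: measurable_branch. Qed.

(** For fixed y the second coordinate of a branch is affine in x with slope 2 - 2a or its
    opposite. *)
Lemma has_area_branch a i A r : a < 1 ->
  has_area A r -> has_area (fun z => A (branch a i z)) (r / (2 - 2 * a)).
Proof.
move=> a1 [mA Ar]; have mA' := measurable_branch_preimage a i mA; split=> //.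
set d := 2 - 2 * a; have d0 : 0 < d by rewrite /d; lra.
have k0 : (0 < d)%R by apply/RltP.
have := @product_lebesgue_affine R d (fun x y => snd (branch a i (x, y))) A k0.
move=> /(_ _ mA mA'); set L := (product_measure1 _ _ _) => H.
have {}H : (d%:E * L = r%:E)%E.
  rewrite -Ar; apply: H => y B mB.
  case: (i).
    rewrite -(lebesgue_measure_affine_neg (2 - 2 * a * y) k0 mB).
    congr (_ * lebesgue_measure _)%E.
    have E x : snd (branch a true (x, y)) = (2 - 2 * a * y) - d * x.
      by rewrite /= /mem_coord /d /=; ring.
    by congr (_ @^-1` B); apply/funext => x; exact: E.
  rewrite -(lebesgue_measure_affine_pos (2 * a * y) k0 mB).
  congr (_ * lebesgue_measure _)%E.
  have E x : snd (branch a false (x, y)) = d * x + 2 * a * y.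
    by rewrite /= /mem_coord /d /=; ring.
  by congr (_ @^-1` B); apply/funext => x; exact: E.
have div_uniq (l t : R) : d * l = t -> l = t / d by move=> <-; field; lra.
have L0 : (0 <= L)%E by exact: (measure_ge0 leb2).
rewrite (_ : leb2 _ = L) //.
(* An infinite area is excluded, since [d] times it is the finite [r]. *)
case: L H L0 => [l||] //.
  by rewrite -EFinM => -[E] _; congr EFin; exact: div_uniq.
by rewrite gt0_muley.
Qed.

(** * Cylinders *)

(* Unlike the closed cylinders, these partition the square for each length of w. *)
Fixpoint cyl (a : R) (w : seq bool) (z : R * R) : Prop :=
  square z /\
  if w is i :: v then
    (if i then 1/2 <= mem_coord a z else mem_coord a z < 1/2) /\ cyl a v (branch a i z)
  else True.

Definition branches (a : R) (w : seq bool) (z : R * R) : R * R :=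
  foldl (fun z i => branch a i z) z w.

Definition cyl_image (a : R) (w : seq bool) (p : R * R) : Prop :=
  exists z, cyl a w z /\ branches a w z = p.

Lemma cyl_square a w z : cyl a w z -> square z.
Proof. by case: w => [|i w] []. Qed.

Lemma cyl_closed a w z : cyl a w z -> closed_cyl a w z.
Proof.
elim: w z => [|i w IH] z //= [sz [hz cz]]; split=> //; split; last exact: IH.
by case: i hz {cz} => /=; lra.
Qed.

Lemma cyl_cat a w v z : cyl a (w ++ v) z <-> cyl a w z /\ cyl a v (branches a w z).
Proof.
elim: w z => [|i w IH] z /=; first by split=> [H|[]//]; split=> //; split=> //; exact: cyl_square H.
rewrite IH; split; first by move=> [? [? []]].
by move=> [[? []]].
Qed.

(** Each defining condition is convex and is pulled back along affine maps. *)
Lemma cyl_seg a w p q z : cyl a w p -> cyl a w q -> on_seg p q z -> cyl a w z.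
Proof.
elim: w p q z => [|i w IH] p q z [sp cp] [sq cq] pqz; split; try exact: square_seg pqz; first by [].
case: cp cq => hp cp [hq cq]; split; last exact: IH cp cq (@branch_seg a i _ _ _ pqz).
case: pqz => t [t01 ->]; rewrite mem_coord_seg; case: i hp hq {cp cq} => hp hq; first by nra.
have := @convex_pos (1/2 - mem_coord a p) (1/2 - mem_coord a q) t; lra.
Qed.

Lemma branches_seg a w p q t :
  branches a w (fst p + t * (fst q - fst p), snd p + t * (snd q - snd p)) =
  (fst (branches a w p) + t * (fst (branches a w q) - fst (branches a w p)),
   snd (branches a w p) + t * (snd (branches a w q) - snd (branches a w p))).
Proof.
elim: w p q => [|i w IH] p q //=.
rewrite -IH; congr (branches a w _); rewrite /branch mem_coord_seg /=.
by case: i; congr pair; ring.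
Qed.

Lemma cyl_image_seg a w p q z :
  cyl_image a w p -> cyl_image a w q -> on_seg p q z -> cyl_image a w z.
Proof.
move=> [p' [cp <-]] [q' [cq <-]] [t [t01 ->]].
exists (fst p' + t * (fst q' - fst p'), snd p' + t * (snd q' - snd p')).
rewrite branches_seg; split=> //; apply: cyl_seg cp cq _; by exists t.
Qed.

Lemma branch_inj a i p q : a < 1 -> branch a i p = branch a i q -> p = q.
Proof.
move=> a1 [e1 e2]; rewrite [p]surjective_pairing [q]surjective_pairing e1; congr pair.
have : mem_coord a p = mem_coord a q by case: i e2; lra.
rewrite /mem_coord e1 => e; apply: (Rmult_eq_reg_l (1 - a)); lra.
Qed.

Lemma branches_inj a w p q : a < 1 -> branches a w p = branches a w q -> p = q.
Proof. by move=> a1; elim: w p q => [|i w IH] p q //= /IH /(branch_inj a1). Qed.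

Lemma cyl_inj a w v z : size w = size v -> cyl a w z -> cyl a v z -> w = v.
Proof.
elim: w v z => [|i w IH] [|j v] z //= [sz] [_ [hi ci]] [_ [hj cj]].
have ij : i = j by case: i j hi hj {ci cj} => -[] // ? ?; exfalso; lra.
by rewrite -ij in cj *; rewrite (IH v _ sz ci cj).
Qed.

Lemma words_size n w : w \in words n -> size w = n.
Proof.
elim: n w => [|n IH] w /=; first by rewrite inE => /eqP ->.
by rewrite mem_cat => /orP[] /mapP[v /IH <- ->].
Qed.

Lemma words_uniq n : uniq (words n).
Proof.
elim: n => //= n IH; rewrite cat_uniq !map_inj_uniq ?IH; [|by move=> ? ? []..].
by rewrite andbT /=; apply/hasPn => _ /mapP[v _ ->]; apply/mapP => -[].
Qed.

Lemma G_branch a z :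
  exists i, (if i then 1/2 <= mem_coord a z else mem_coord a z < 1/2) /\ G a z = branch a i z.
Proof.
rewrite /G /tent -/(mem_coord a z); case: Rlt_dec => h.
  by exists false.
by exists true; split=> //; lra.
Qed.

Lemma G_square a z : 0 < a < 1 -> square z -> square (G a z).
Proof.
move=> a01 sz; have [i [hi ->]] := G_branch a z; apply: branch_square => //.
by case: i hi => /=; lra.
Qed.

Lemma iter_G_square a n z : 0 < a < 1 -> square z -> square (iter n (G a) z).
Proof. by move=> a01 sz; elim: n => //= n; exact: G_square. Qed.

Lemma cyl_cover a n z : 0 < a < 1 -> square z ->
  exists w, [/\ w \in words n, cyl a w z & iter n (G a) z = branches a w z].
Proof.
move=> a01; elim: n z => [|n IH] z sz; first by exists [::]; rewrite mem_head.
have [i [hi Gi]] := G_branch a z.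
have [w [wn cw Gw]] := IH _ (G_square a01 sz).
exists (i :: w); split.
- by rewrite mem_cat; apply/orP; case: i {hi Gi}; [right|left]; apply: map_f.
- by split=> //; split=> //; rewrite -Gi.
- by rewrite iterSr Gw Gi.
Qed.

Lemma iter_G_cyl a w z : cyl a w z -> iter (size w) (G a) z = branches a w z.
Proof.
elim: w z => [|i w IH] z //= [sz [hi cz]].
rewrite -iterS iterSr.
have [j [hj Gj]] := G_branch a z.
have ij : i = j by case: i j hi hj {cz Gj} => -[] // ? ?; exfalso; lra.
by rewrite Gj -ij; exact: IH.
Qed.

Lemma measurable_square : measurable (square : set plane).
Proof. exact: (measurable_rect 0 1 0 1). Qed.

Lemma measurable_cyl a w : measurable (cyl a w : set plane).
Proof.
elim: w => [|i w IH].
  rewrite (_ : cyl a [::] = square); first exact: measurable_square.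
  by apply/funext => z; apply/propext; split=> [[]|].
have mh : measurable ((fun z => if i then 1/2 <= mem_coord a z else mem_coord a z < 1/2) : set plane).
  case: i.
    rewrite (_ : (fun z => _) = mem_coord a @^-1` `[1/2, +oo[%classic).
      rewrite -[X in measurable X]setTI; exact: measurable_mem_coord.
    by apply/seteqP; split=> z /=; rewrite in_itv /= andbT => /RleP.
  rewrite (_ : (fun z => _) = mem_coord a @^-1` `]-oo, 1/2[%classic).
    rewrite -[X in measurable X]setTI; exact: measurable_mem_coord.
  by apply/seteqP; split=> z /=; rewrite in_itv /= => /RltP.
exact: (measurableI _ _ measurable_square (measurableI _ _ mh (measurable_branch_preimage a i IH))).
Qed.

Lemma has_area_branches a w A r : a < 1 -> has_area A r ->
  has_area (fun z => A (branches a w z)) (r / (2 - 2 * a) ^ size w).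
Proof.
move=> a1; elim: w A r => [|i w IH] A r hA /=.
  by rewrite /Rdiv Rinv_1 Rmult_1_r.
have := has_area_branch i a1 (IH _ _ hA).
rewrite (_ : _ / _ / _ = r / ((2 - 2 * a) * (2 - 2 * a) ^ size w)) //.
have := pow_nonzero (2 - 2 * a) (size w); move=> /(_ ltac:(lra)) H.
by field; split=> //; lra.
Qed.

(** * Fat cylinders and the cylinder count *)

Lemma Rabs_mult_le x y b : Rabs x <= b -> Rabs y <= 1 -> Rabs (x * y) <= b.
Proof. by move=> xb y1; rewrite Rabs_mult; have := Rabs_pos x; have := Rabs_pos y; nra. Qed.

(* Barycentric coordinates: they equal 1/3 at the centroid of the triangle pqr and move by at
   most 2(eta/6)/|det3 p q r| on the square of half side eta/6. *)
Lemma triangle_square (S : R * R -> Prop) p q r eta :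
  (forall x y z, S x -> S y -> on_seg x y z -> S z) ->
  S p -> S q -> S r -> square p -> square q -> square r ->
  0 < eta -> eta <= Rabs (det3 p q r) ->
  forall x, Rabs (fst x - (fst p + fst q + fst r) / 3) <= eta / 6 ->
    Rabs (snd x - (snd p + snd q + snd r) / 3) <= eta / 6 -> S x.
Proof.
move=> convS Sp Sq Sr sp sq sr eta0 etaD x x1 x2.
have diff u v : square u -> square v -> Rabs (fst u - fst v) <= 1 /\ Rabs (snd u - snd v) <= 1.
  by move=> [[? ?] [? ?]] [[? ?] [? ?]]; split; apply: Rabs_le; lra.
set D := det3 p q r in etaD *.
set v1 := fst x - _ in x1; set v2 := snd x - _ in x2.
have D0 : D <> 0 by move=> D0; move: etaD; rewrite D0 Rabs_R0; lra.
have nonneg e f g : square f -> square g ->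
    e = D / 3 + (v1 * (snd f - snd g) - v2 * (fst f - fst g)) -> 0 <= e / D.
  move=> sf sg ->; have [d1 d2] := diff f g sf sg.
  have b1 := @Rabs_bounds _ _ (Rabs_mult_le x1 d2).
  have b2 := @Rabs_bounds _ _ (Rabs_mult_le x2 d1).
  set E := _ - _; have EB : - (eta / 3) <= E <= eta / 3 by rewrite /E; lra.
  (* The sign is that of (D/3 + E) D, which is nonnegative because |E| <= eta/3 <= |D|/3. *)
  have -> : (D / 3 + E) / D = (D / 3 + E) * D * (/ D) ^ 2 by field.
  apply: Rmult_le_pos; last exact: pow2_ge_0.
  move: etaD; rewrite /Rabs; case: Rcase_abs => ? ?; nra.
have l1 : 0 <= det3 x q r / D.
  apply: (nonneg _ q r) => //; rewrite /v1 /v2 /D /det3; field.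
have l2 : 0 <= det3 p x r / D.
  apply: (nonneg _ r p) => //; rewrite /v1 /v2 /D /det3; field.
have l3 : 0 <= det3 p q x / D.
  apply: (nonneg _ p q) => //; rewrite /v1 /v2 /D /det3; field.
have l123 : det3 x q r / D + det3 p x r / D + det3 p q x / D = 1.
  have E : det3 x q r + det3 p x r + det3 p q x = D by rewrite /D /det3; ring.
  by rewrite /Rdiv -!Rmult_plus_distr_r E; field.
have ex1 : fst x = det3 x q r / D * fst p + det3 p x r / D * fst q + det3 p q x / D * fst r.
  apply: (Rmult_eq_reg_l D) => //; rewrite !Rmult_plus_distr_l.
  rewrite (_ : D * (det3 x q r / D * fst p) = det3 x q r * fst p); last by field.
  rewrite (_ : D * (det3 p x r / D * fst q) = det3 p x r * fst q); last by field.
  rewrite (_ : D * (det3 p q x / D * fst r) = det3 p q x * fst r); last by field.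
  by rewrite /D /det3; ring.
have ex2 : snd x = det3 x q r / D * snd p + det3 p x r / D * snd q + det3 p q x / D * snd r.
  apply: (Rmult_eq_reg_l D) => //; rewrite !Rmult_plus_distr_l.
  rewrite (_ : D * (det3 x q r / D * snd p) = det3 x q r * snd p); last by field.
  rewrite (_ : D * (det3 p x r / D * snd q) = det3 p x r * snd q); last by field.
  rewrite (_ : D * (det3 p q x / D * snd r) = det3 p q x * snd r); last by field.
  by rewrite /D /det3; ring.
move: l1 l2 l3 l123 ex1 ex2.
move: (det3 x q r / D) (det3 p x r / D) (det3 p q x / D) => l1 l2 l3 l1p l2p l3p l123 ex1 ex2.
rewrite [x]surjective_pairing ex1 ex2.
(* If l1 = 1 the point is [p]; otherwise it lies on the segment from [p] to a point [y] of the side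
   [q r], and convexity is used twice. *)
case: (Req_dec l1 1) => l11.
  have [-> ->] : l2 = 0 /\ l3 = 0 by split; lra.
  rewrite l11 (_ : (_, _) = p) //; rewrite [RHS]surjective_pairing; congr pair; ring.
pose y := (fst q + l3 / (l2 + l3) * (fst r - fst q), snd q + l3 / (l2 + l3) * (snd r - snd q)).
have l23 : l2 + l3 <> 0 by lra.
have Sy : S y.
  apply: convS Sq Sr _; exists (l3 / (l2 + l3)); split=> //.
  have E : l3 / (l2 + l3) * (l2 + l3) = l3 by field.
  by split; nra.
apply: convS Sp Sy _; exists (l2 + l3); split; first lra.
rewrite /y /= (_ : l1 = 1 - l2 - l3); last lra.
by congr pair; field.
Qed.

(** An axis-parallel square stands in for the triangle that contains it, because its area is that of
    a rectangle. *)
Definition fat (a delta : R) (w : seq bool) : Prop :=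
  exists q, forall x, Rabs (fst x - fst q) <= delta -> Rabs (snd x - snd q) <= delta ->
    cyl_image a w x.

Lemma fat_area a delta w : a < 1 -> 0 < delta -> fat a delta w ->
  exists2 r, has_area (cyl a w) r & (2 * delta) ^ 2 / (2 - 2 * a) ^ size w <= r.
Proof.
move=> a1 delta0 [q qP].
have hsq : has_area square ((1 - 0) * (1 - 0)) by apply: (@has_area_rect 0 1 0 1); lra.
have [r hr] := has_area_sub (measurable_cyl a w) hsq (@cyl_square a w).
exists r => //.
have hq : has_area (rect (fst q - delta) (fst q + delta) (snd q - delta) (snd q + delta))
    ((2 * delta) ^ 2).
  rewrite (_ : (2 * delta) ^ 2 = (fst q + delta - (fst q - delta)) * (snd q + delta - (snd q - delta))).
    by apply: has_area_rect; lra.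
  ring.
apply: has_area_mono (has_area_branches w a1 hq) hr _ => z [z1 z2].
have [|| z' [cz' /(branches_inj a1) <-]] := qP (branches a w z) => //; apply: Rabs_le; lra.
Qed.

(** Cylinders of equal length are disjoint in the unit square, and each fat one has area at least (2
    delta)^2 / (2 - 2a)^n. *)
Lemma fat_cnt a delta n : 0 < a < 1 -> 0 < delta ->
  cnt n (fat a delta) * (2 * delta) ^ 2 <= (2 - 2 * a) ^ n.
Proof.
move=> a01 delta0.
have d0 : 0 < (2 - 2 * a) ^ n by apply: pow_lt; lra.
set c := (2 * delta) ^ 2.
have key (s : seq (seq bool)) : uniq s -> (forall w, w \in s -> fat a delta w /\ size w = n) ->
    exists2 r, has_area (fun z => exists2 w, w \in s & cyl a w z) r &
      INR (size s) * (c / (2 - 2 * a) ^ n) <= r.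
  elim: s => [_ _|w s IH /=/andP[ws us] H].
    exists 0; last by rewrite /=; lra.
    by apply: has_area_ext has_area0 => z; split=> // -[].
  have [|r hr rs] := IH us; first by move=> v vs; apply: H; rewrite inE vs orbT.
  have [fw wn] := H w (mem_head _ _).
  have [r' hr' r's] := fat_area (proj2 a01) delta0 fw; rewrite wn in r's.
  exists (r' + r).
    apply: has_area_ext (has_area_disjU hr' hr _).
      move=> z; split=> [[cz|[v vs cz]]|[v]].
      - by exists w => //; rewrite mem_head.
      - by exists v => //; rewrite inE vs orbT.
      - by rewrite inE => /orP[/eqP ->|vs] cz; [left|right; exists v].
    move=> z cw [v vs cv]; have [_ vn] : fat a delta v /\ size v = n by apply: H; rewrite inE vs orbT.
    by move: ws; rewrite (cyl_inj _ cw cv) ?vs // wn vn.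
  by rewrite -/(INR (size s).+1) S_INR; rewrite -/c in r's; lra.
have [||r hr rs] := key [seq w <- words n | `[< fat a delta w >]].
- by rewrite filter_uniq // words_uniq.
- by move=> w; rewrite mem_filter => /andP[/asboolP fw /words_size].
have hsq : has_area square ((1 - 0) * (1 - 0)) by apply: (@has_area_rect 0 1 0 1); lra.
have r1 : r <= (1 - 0) * (1 - 0).
  by apply: has_area_mono hr hsq _ => z [w _ /cyl_square].
rewrite size_filter -/(cnt n (fat a delta)) in rs.
have -> : cnt n (fat a delta) * c = cnt n (fat a delta) * (c / (2 - 2 * a) ^ n) * (2 - 2 * a) ^ n.
  by field; lra.
nra.
Qed.

(** A fat prefix has at most 2^N suffixes, and [fat_cnt] bounds the number of fat prefixes. For any
    other prefix, points of its image chosen in different N-cylinders span only triangles of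
    determinant below eta, since a larger triangle would contain a square of half side eta/6;
    [flat_family_bound] then allows [K] suffixes. *)
Lemma cyl_cnt_step a N K : 0 < a < 1 -> 0 <= K ->
  (forall p q, square p -> square q -> seg_cnt a N p q <= K) ->
  exists B, 0 <= B /\ forall n, cnt (n + N) (fun w => exists z, cyl a w z) <=
    B * (2 - 2 * a) ^ n + K * cnt n (fun w => exists z, cyl a w z).
Proof.
move=> a01 K0 segK.
have [eta eta0 flat] := flat_family_bound K0 segK.
have delta0 : 0 < eta / 6 by lra.
set c := (2 * (eta / 6)) ^ 2; have c0 : 0 < c by apply: pow_lt; lra.
have p2 : 0 < 2 ^ N by apply: pow_lt; lra.
exists (2 ^ N / c); split; first by apply/Rlt_le/Rdiv_lt_0_compat.
move=> n.
have H : cnt (n + N) (fun w => exists z, cyl a w z) <=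
    2 ^ N * cnt n (fat a (eta / 6)) + K * cnt n (fun w => exists z, cyl a w z).
  apply: cnt_cat => w wn.
  case: asboolP => [_|nfat].
    have := @cnt_le_pow2 N (fun v => exists z, cyl a (w ++ v) z); case: asboolP => _; lra.
  rewrite Rplus_0_l; case: asboolP => [_|nE]; last first.
    rewrite cnt_false; first lra.
    by move=> v [z /cyl_cat[cz _]]; apply: nE; exists z.
  have /choice[p pP] : forall v, exists x : R * R, (exists z, cyl a (w ++ v) z) ->
      cyl_image a w x /\ cyl a v x.
    move=> v; case: (pselect (exists z, cyl a (w ++ v) z)) => [[z cz]|nz]; last by exists (0, 0).
    exists (branches a w z) => _; move/cyl_cat: cz => [cw cv]; split=> //; by exists z.
  apply: (flat _ p) => [v /pP[_]|u v t /pP[Qu cu] /pP[Qv cv] /pP[Qt ct]].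
    exact: cyl_closed.
  apply: Rnot_le_lt => big; apply: nfat.
  exists ((fst (p u) + fst (p v) + fst (p t)) / 3, (snd (p u) + snd (p v) + snd (p t)) / 3) => x.
  apply: (triangle_square (@cyl_image_seg a w) Qu Qv Qt) => //;
    [exact: cyl_square cu|exact: cyl_square cv|exact: cyl_square ct].
apply: Rle_trans H _; apply: Rplus_le_compat_r.
have := @fat_cnt a (eta / 6) n a01 delta0; rewrite -/c => H.
have -> : 2 ^ N / c * (2 - 2 * a) ^ n = 2 ^ N * ((2 - 2 * a) ^ n / c) by field; lra.
apply: Rmult_le_compat_l; first lra.
apply: (Rmult_le_reg_r c) => //.
by have -> : (2 - 2 * a) ^ n / c * c = (2 - 2 * a) ^ n by field; lra.
Qed.

Lemma cyl_cnt_bound a : 0 < a < 1/4 -> exists C, 0 < C /\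
  forall n, cnt n (fun w => exists z, cyl a w z) <= C * (2 - 2 * a) ^ n.
Proof.
move=> a01; have [rho [C0 [rho1 rhod C0pos segC]]] := @seg_cnt_bound a a01.
set d := 2 - 2 * a in rhod *.
have d32 : 3/2 < d by rewrite /d; lra.
have [||N0 HN] := @pow_lt_1_zero (rho / d) _ (/ (2 * C0)) _.
- rewrite Rabs_pos_eq; last by apply/Rlt_le/Rdiv_lt_0_compat; lra.
  by apply: (Rmult_lt_reg_r d); [lra|rewrite (_ : rho / d * d = rho); [lra|field; lra]].
- by apply: Rinv_0_lt_compat; lra.
(* The successor makes [N] positive, so that the induction descends from n to n - N. *)
pose N := N0.+1.
have dN : 0 < d ^ N by apply: pow_lt; lra.
have K2 : C0 * rho ^ N <= d ^ N / 2.
  have := HN N (ssrnat.leP (leqnSn _)); rewrite Rabs_pos_eq;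
    last by apply/pow_le/Rlt_le/Rdiv_lt_0_compat; lra.
  rewrite /Rdiv Rpow_mult_distr pow_inv => /Rlt_le H.
  have : rho ^ N * / d ^ N * d ^ N * (2 * C0) <= / (2 * C0) * d ^ N * (2 * C0).
    by apply: Rmult_le_compat_r; [lra|apply: Rmult_le_compat_r; lra].
  have -> : rho ^ N * / d ^ N * d ^ N * (2 * C0) = 2 * (C0 * rho ^ N) by field; lra.
  have -> : / (2 * C0) * d ^ N * (2 * C0) = d ^ N by field; lra.
  lra.
have rN : 0 < rho ^ N by apply: pow_lt; lra.
have [||B [B0 step]] := @cyl_cnt_step a N (C0 * rho ^ N) _ _ (fun p q sp sq => segC N p q sp sq).
- by lra.
- by nra.
have p2 : 0 < 2 ^ N by apply: pow_lt; lra.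
(* 2^N settles n < N; B <= C/2 and d^N >= 1 close the recursion with factor d^N / 2. *)
pose C := 2 ^ N + 2 * B; have Cpos : 0 < C by rewrite /C; lra.
exists C; split=> //; elim/ltn_ind => n IH.
case: (ltnP n N) => nN.
  apply: Rle_trans (cnt_le_pow2 _ _) _.
  have : 2 ^ n <= 2 ^ N by apply: Rle_pow; [lra|apply/ssrnat.leP/ltnW].
  have : 1 <= d ^ n by apply: pow_R1_Rle; lra.
  rewrite /C; nra.
have := step (n - N)%N; rewrite subnK // => H; apply: Rle_trans H _.
have IHn := IH (n - N)%N; rewrite ltn_subrL /= in IHn.
have {}IHn := IHn (leq_ltn_trans (leq0n _) nN).
have -> : d ^ n = d ^ (n - N) * d ^ N by rewrite -pow_add; congr (d ^ _); rewrite -[LHS](subnK nN).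
have dn : 0 < d ^ (n - N) by apply: pow_lt; lra.
rewrite -/d; set M := cnt _ _ in IHn *.
have M0 : 0 <= M by exact: cnt_ge0.
have : C0 * rho ^ N * M <= d ^ N / 2 * (C * d ^ (n - N)).
  by apply: Rmult_le_compat => //; nra.
have : 1 <= d ^ N by apply: pow_R1_Rle; lra.
have BC : 2 * B <= C by rewrite /C; lra.
move=> dN1 H1.
have : B * d ^ (n - N) <= d ^ N / 2 * (C * d ^ (n - N)).
  rewrite (_ : d ^ N / 2 * (C * d ^ (n - N)) = (d ^ N * (C / 2)) * d ^ (n - N)); last by field.
  by apply: Rmult_le_compat_r; nra.
lra.
Qed.

(** The n-cylinders cut the preimage into at most C (2 - 2a)^n nonempty pieces, each of area at most
    r / (2 - 2a)^n. *)
Lemma iter_G_area a : 0 < a < 1/4 -> exists C, 0 < C /\ forall n A r, has_area A r ->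
  exists2 s, has_area (fun z => square z /\ A (iter n (G a) z)) s & s <= C * r.
Proof.
move=> a01; have [C [C0 HC]] := cyl_cnt_bound a01.
exists C; split=> // n A r hA.
have r0 := has_area_ge0 hA.
set d := 2 - 2 * a in HC *; have d32 : 3/2 < d by rewrite /d; lra.
have dn : 0 < d ^ n by apply: pow_lt; lra.
have key (s : seq (seq bool)) : (forall w, w \in s -> size w = n) ->
    exists2 t, has_area (fun z => exists2 w, w \in s & cyl a w z /\ A (branches a w z)) t &
      t <= INR (count (fun w => `[< exists z, cyl a w z >]) s) * (r / d ^ n).
  elim: s => [_|w s IH H].
    exists 0; last by rewrite /=; lra.
    by apply: has_area_ext has_area0 => z; split=> // -[].
  have [|t ht ts] := IH; first by move=> v vs; apply: H; rewrite inE vs orbT.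
  rewrite /= plus_INR.
  case: asboolP => [_|nE].
    have hw := has_area_branches w (ltac:(lra) : a < 1) hA; rewrite (H w (mem_head _ _)) -/d in hw.
    have mw : measurable ((fun z => cyl a w z /\ A (branches a w z)) : set plane).
      by apply: (measurableI _ _ (measurable_cyl a w)); case: hw.
    have [u hu] := has_area_sub mw hw (fun z => @proj2 _ _).
    have [v hv vs] := has_area_U hu ht; exists v.
      apply: has_area_ext hv => z; split=> [[cz|[v' vs' cz]]|[v']].
      - by exists w => //; rewrite mem_head.
      - by exists v' => //; rewrite inE vs' orbT.
      - by rewrite inE => /orP[/eqP ->|vs'] cz; [left|right; exists v'].
    have : u <= r / d ^ n by apply: has_area_mono hu hw _ => z [].
    by rewrite /=; lra.
  exists t; last by rewrite /=; lra.
  apply: has_area_ext ht => z; split=> [[v vs cz]|[v]].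
    by exists v => //; rewrite inE vs orbT.
  rewrite inE => /orP[/eqP ->|vs] cz; last by exists v.
  by exfalso; apply: nE; exists z; case: cz.
have [|t ht ts] := key (words n); first exact: words_size.
exists t.
  apply: has_area_ext ht => z; split=> [[w wn [cz Az]]|[sz Az]].
    split; first exact: cyl_square cz.
    by rewrite -{1}(words_size wn) iter_G_cyl.
  have [|w [wn cw Gw]] := @cyl_cover a n z _ sz; first lra.
  by exists w => //; rewrite -Gw.
apply: Rle_trans ts _; rewrite -/(cnt n _).
have -> : C * r = C * d ^ n * (r / d ^ n) by field; lra.
apply: Rmult_le_compat_r; last exact: HC.
by apply: Rmult_le_pos => //; apply/Rlt_le/Rinv_0_lt_compat.
Qed.

(** * The invariant measure *)

Lemma sum_f_R0_le_mul (f : nat -> R) b n : (forall k, f k <= b) -> sum_f_R0 f n <= b * (INR n + 1).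
Proof.
move=> fb; elim: n => [|n IH]; first by rewrite /=; have := fb 0%N; lra.
by rewrite -/(sum_f_R0 f n.+1) tech5 S_INR; have := fb n.+1; lra.
Qed.

(** Reduces countable additivity to small tails. It is applied both to area and to the limit
    measure, whose tail is at most a constant times the tail of the areas. *)
Lemma additive_split (F : (R * R -> Prop) -> R) (A : nat -> R * R -> Prop) :
  (forall B, borel B -> forall D, borel D -> (forall z, B z -> D z -> False) ->
    F (fun z => B z \/ D z) = F B + F D) ->
  (forall n, borel (A n)) -> (forall m n z, m <> n -> A m z -> A n z -> False) ->
  forall N, F (fun z => exists n, A n z) =
    sum_f_R0 (fun n => F (A n)) N + F (fun z => exists n, A (n + N.+1)%N z).
Proof.
move=> addF bA dA.
have step N : F (fun z => exists n, A (n + N)%N z) =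
    F (A N) + F (fun z => exists n, A (n + N.+1)%N z).
  rewrite -addF //.
  - congr F; apply/funext => z; apply/propext; split.
      move=> [[|n]]; first by rewrite add0n; left.
      by rewrite addSnnS; right; exists n.
    move=> [Az|[n Az]]; first by exists 0%N.
    by exists n.+1; rewrite addSnnS.
  - by apply: borel_union => n; exact: bA.
  - move=> z Az [n An]; apply: (dA N (n + N.+1)%N z) => //.
    by move=> E; have := leq_addl n N.+1; rewrite -E ltnn.
elim=> [|N IH].
  rewrite -step; congr F; apply/funext => z; apply/propext.
  by split=> -[n]; [exists n; rewrite addn0|rewrite addn0; exists n].
by rewrite IH step tech5; ring.
Qed.

(* mu is an ultralimit of Cesaro means of pushforwards of Lebesgue measure; the uniform density
   bound C passes to the limit, which gives both countable additivity and absolute continuity. *)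
Lemma acim_exists a : 0 < a < 1/4 -> exists mu : (R * R -> Prop) -> R,
  is_probability_measure mu /\ absolutely_continuous mu /\ invariant (G a) mu.
Proof.
move=> a01; have [C [C0 dens]] := iter_G_area a01.
have [U [U1 U2 U3 U4 U5]] := ultrafilter_nat.
pose ok (A : R * R -> Prop) := exists r, has_area A r.
pose pre k (A : R * R -> Prop) z := square z /\ A (iter k (G a) z).
pose area (A : R * R -> Prop) := fine (leb2 (A : set plane)).
have areaE A r : has_area A r -> area A = r by rewrite /area => -[_ ->].
have areaP A : ok A -> has_area A (area A) by move=> [r hr]; rewrite (areaE _ _ hr).
have sqA : has_area square 1.
  by rewrite (_ : 1 = (1 - 0) * (1 - 0)); [apply: (@has_area_rect 0 1 0 1); lra|ring].
have ok_borel A : borel A -> ok A.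
  by move=> /borel_measurable[mA sA]; exact: has_area_sub mA sqA sA.
have ok_pre k A : ok A -> ok (pre k A).
  by move=> [r hr]; have [s hs _] := dens k A r hr; exists s.
pose m A k := area (pre k A).
have m_le A k : ok A -> m A k <= C * area A.
  move=> oA; have [s hs sr] := dens k A _ (areaP _ oA).
  by rewrite /m (areaE _ _ hs).
have m01 A k : ok A -> 0 <= m A k <= 1.
  move=> oA; have h := areaP _ (ok_pre k _ oA); split; first exact: has_area_ge0 h.
  by apply: has_area_mono h sqA _ => z [].
have m_square k : m square k = 1.
  apply: areaE; apply: has_area_ext sqA => z; split=> [sz|[]//].
  by split=> //; apply: iter_G_square => //; lra.
have m_add A B k : ok A -> ok B -> (forall z, A z -> B z -> False) ->
    m (fun z => A z \/ B z) k = m A k + m B k.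
  move=> oA oB dAB; apply: areaE.
  apply: has_area_ext (has_area_disjU (areaP _ (ok_pre k _ oA)) (areaP _ (ok_pre k _ oB)) _).
    by move=> z; rewrite /pre; tauto.
  by move=> z [_ Az] [_ Bz]; exact: dAB Az Bz.
pose avg A n := sum_f_R0 (m A) n / (INR n + 1).
have n0 n : 0 < INR n + 1 by have := pos_INR n; lra.
have avg_le A b n : (forall k, m A k <= b) -> avg A n <= b.
  move=> H; apply: (Rmult_le_reg_r (INR n + 1)) => //.
  rewrite (_ : avg A n * (INR n + 1) = sum_f_R0 (m A) n); first exact: sum_f_R0_le_mul.
  by rewrite /avg; field; have := n0 n; lra.
have avg_ge0 A n : ok A -> 0 <= avg A n.
  move=> oA; apply: Rmult_le_pos; last exact/Rlt_le/Rinv_0_lt_compat.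
  by apply: cond_pos_sum => k; case: (m01 A k oA).
have [mu muP] : exists mu : (R * R -> Prop) -> R, forall A, ok A -> ulim U (avg A) (mu A).
  have /choice[mu muP] : forall A : R * R -> Prop, exists l, ok A -> ulim U (avg A) l.
    move=> A; case: (pselect (ok A)) => oA; last by exists 0.
    have [|l ul] := @ulim_exists U U1 U2 U3 U4 (avg A) 0 1; last by exists l.
    apply: (U_all U1 U5) => n; split; first exact: avg_ge0.
    by apply: avg_le => k; case: (m01 A k oA).
  by exists mu.
have mu_ge0 A : ok A -> 0 <= mu A.
  move=> oA; apply: (@ulim_ge U U1 U2 U3 U5 _ _ _ (muP _ oA)).
  by apply: (U_all U1 U5) => n; exact: avg_ge0.
have mu_le A : ok A -> mu A <= C * area A.
  move=> oA; apply: (@ulim_le U U1 U2 U3 _ _ _ (muP _ oA)).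
  by apply: (U_all U1 U5) => n; apply: avg_le => k; exact: m_le.
have mu_add B : borel B -> forall D, borel D -> (forall z, B z -> D z -> False) ->
    mu (fun z => B z \/ D z) = mu B + mu D.
  move=> /ok_borel oB D /ok_borel oD dBD.
  have oU : ok (fun z => B z \/ D z).
    by exists (area B + area D); apply: has_area_disjU => //; exact: areaP.
  apply: (@ulim_unique U U1 U2 U3 _ _ _ (muP _ oU)).
  apply: (@ulim_ext U U1 U2 _ _ _ _ (@ulim_add U U1 U2 _ _ _ _ (muP _ oB) (muP _ oD))).
  apply: (U_all U1 U5) => n; rewrite /avg /Rdiv -Rmult_plus_distr_r -sum_plus.
  by congr (_ * _); apply: PartSum.sum_eq => k _; rewrite m_add.
have area_add B : borel B -> forall D, borel D -> (forall z, B z -> D z -> False) ->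
    area (fun z => B z \/ D z) = area B + area D.
  move=> /ok_borel oB D /ok_borel oD dBD.
  by apply/areaE/has_area_disjU => //; exact: areaP.
exists mu; split; [split; [|split]|split].
- by move=> A /ok_borel; exact: mu_ge0.
- have oS : ok square by exists 1.
  apply: (@ulim_unique U U1 U2 U3 _ _ _ (muP _ oS)).
  apply: (@ulim_ext U U1 U2 _ _ _ _ (@ulim_const U U1 U5 1)).
  apply: (U_all U1 U5) => n; rewrite /avg (PartSum.sum_eq _ (fun=> 1)); last by move=> k _; exact: m_square.
  by rewrite sum_cte S_INR; field; have := n0 n; lra.
- move=> A bA dA.
  have bU := borel_union _ bA.
  have cv := has_area_sigma (fun n => areaP _ (ok_borel _ (bA n))) (areaP _ (ok_borel _ bU)) dA.
  move=> e e0; have [N HN] := cv (e / C) (Rdiv_lt_0_compat _ _ e0 C0).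
  exists N => n nN; have {HN} := HN n nN.
  rewrite /Rdist (additive_split area_add bA dA n) (additive_split mu_add bA dA n).
  have oT : ok (fun z => exists k, A (k + n.+1)%N z).
    by apply/ok_borel/borel_union => k; exact: bA.
  have T1 := mu_le _ oT; have T2 := mu_ge0 _ oT.
  rewrite (_ : forall x y, x - (x + y) = - y); last by move=> x y; ring.
  rewrite (_ : forall x y, x - (x + y) = - y); last by move=> x y; ring.
  rewrite !Rabs_Ropp (Rabs_pos_eq (mu _)) // Rabs_pos_eq; last first.
    exact: has_area_ge0 (areaP _ oT).
  move=> H; apply: Rle_lt_trans T1 _.
  have := Rmult_lt_compat_l _ _ _ C0 H.
  by have -> : C * (e / C) = e by field; lra.
- move=> A bA nA; have oA := ok_borel _ bA.
  have [mA _] := borel_measurable bA.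
  have := mu_le _ oA; have := mu_ge0 _ oA.
  rewrite (areaE _ _ (null_area mA nA)); lra.
- move=> A bA; have oA := ok_borel _ bA.
  have oB : ok (pre 1%N A) := ok_pre 1%N _ oA.
  rewrite -/(pre 1%N A).
  have shift k : m (pre 1%N A) k = m A k.+1.
    congr area; apply/funext => z; apply/propext; rewrite /pre; split.
      by move=> [sz [_ Az]]; split.
    by move=> [sz Az]; split=> //; split=> //; apply: iter_G_square => //; lra.
  (* Shifting the Cesaro sum by one changes only its two end terms, both between 0 and 1. *)
  have diff n : avg (pre 1%N A) n - avg A n = (m A n.+1 - m A 0%N) / (INR n + 1).
    rewrite /avg -Rdiv_minus_distr; congr (_ / _).
    rewrite (PartSum.sum_eq _ (fun k => m A k.+1)); last by move=> k _; exact: shift.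
    have := decomp_sum (m A) n.+1 (Nat.lt_0_succ n); rewrite tech5 /=; lra.
  apply: (@ulim_unique U U1 U2 U3 _ _ _ (muP _ oB)) => e e0.
  have e2 : 0 < e / 2 by lra.
  have [M [Me M0]] := archimed_cor1 _ e2.
  apply: (U1) (U2 _ _ (muP _ oA _ e2) (U5 M)) => n [/Rabs_def2 h nM].
  have dn : Rabs (avg (pre 1%N A) n - avg A n) < e / 2.
    rewrite diff Rabs_mult; have i0 := Rinv_0_lt_compat _ (n0 n).
    rewrite (Rabs_pos_eq (/ _)); last lra.
    have d1 : Rabs (m A n.+1 - m A 0%N) <= 1.
      by have := m01 A n.+1 oA; have := m01 A 0%N oA => ? ?; apply: Rabs_le; lra.
    have : / (INR n + 1) <= / INR M.
      apply: Rinv_le_contravar; first exact: lt_0_INR.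
      by have : INR M <= INR n; [apply/le_INR/ssrnat.leP|lra].
    nra.
  by move: dn => /Rabs_def2 dn; apply: Rabs_def1; lra.
Qed.

(** The quartic equals 1/16 at 1/4, and the cofactor of x - 1/4 is positive on [0,1] because its
    quadratic part has negative discriminant; hence no root lies in [1/4,1]. *)
Lemma quartic_root_lt x : 0 <= x <= 1 ->
  16 * x ^ 4 + 16 * x ^ 3 - 52 * x ^ 2 + 48 * x - 9 = 0 -> x < 1/4.
Proof.
move=> x01 rx; apply: Rnot_le_lt => x4.
have E : 16 * x ^ 4 + 16 * x ^ 3 - 52 * x ^ 2 + 48 * x - 9 =
    (x - 1/4) * (16 * x ^ 3 + 20 * x ^ 2 - 47 * x + 145/4) + 1/16 by field.
have x3 : 0 <= x ^ 3 by apply: pow_le; lra.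
have : 0 < 20 * x ^ 2 - 47 * x + 145/4 by nra.
nra.
Qed.

Theorem theorem1 :
  forall alpha1 : R,
    0 <= alpha1 <= 1 ->
    16 * alpha1 ^ 4 + 16 * alpha1 ^ 3 - 52 * alpha1 ^ 2 + 48 * alpha1 - 9 = 0 ->
    forall alpha : R, 0 < alpha <= alpha1 ->
      exists mu : (R * R -> Prop) -> R,
        is_probability_measure mu /\ absolutely_continuous mu /\
        invariant (G alpha) mu.
Proof.
move=> alpha1 h01 root alpha h; apply: acim_exists.
have := quartic_root_lt h01 root; lra.
Qed.
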